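(* Let $u,v\in\mathcal{M}_d$ with $u\geq_{lex}v$, $x_1\mid u$ and $x_1\nmid v$, let $I=(L(u,v))$ be the corresponding lexsegment ideal, and assume $\operatorname{depth}(S/I)>0$. Let $l=\min(u/x_1)$ and let $a_l$ be the exponent of $x_l$ in $u/x_1$. (i) Let $\operatorname{depth}(S/I)=1$. Then: (a) if $a_l<d-1$, $$\operatorname{Ass}(S/I)=\{(x_2,\ldots,x_n)\}\cup\{(x_1,\ldots,x_j) : j\in \operatorname{supp}(v)\setminus\{n\}\}\cup\{P_{j,l} : j\in\operatorname{supp}(v),\ j\leq l-2\}\cup\{P_{j,l+1} : j\in\operatorname{supp}(v),\ j\leq l-1\};$$ (b) if $a_l=d-1$, $$\operatorname{Ass}(S/I)=\{(x_2,\ldots,x_n)\}\cup\{(x_1,\ldots,x_j) : j\in \operatorname{supp}(v)\setminus\{n\}\}\cup\{P_{j,l} : j\in\operatorname{supp}(v),\ j\leq l-2\}.$$ (ii) Let $\operatorname{depth}(S/I)>1$. Then: (a) if $a_l<d-1$, $$\operatorname{Ass}(S/I)=\{(x_1,\ldots,x_j) : j\in \operatorname{supp}(v)\setminus\{n\}\}\cup\{P_{j,l} : j\in\operatorname{supp}(v)\}\cup\{P_{j,l+1} : j\in\operatorname{supp}(v)\};$$ (b) if $a_l=d-1$, $$\operatorname{Ass}(S/I)=\{(x_1,\ldots,x_j) : j\in \operatorname{supp}(v)\setminus\{n\}\}\cup\{P_{j,l} : j\in\operatorname{supp}(v)\}.$$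
   Context: $K$ is a field, $S=K[x_1,\ldots,x_n]$, and monomials of $S$ are ordered by the lexicographical order $\geq_{lex}$ induced by $x_1>x_2>\cdots>x_n$. Let $d\geq 2$ be an integer and $\mathcal{M}_d$ the set of monomials of degree $d$ of $S$. For $u,v\in\mathcal{M}_d$ with $u\geq_{lex}v$, $L(u,v)=\{w\in\mathcal{M}_d : u\geq_{lex}w\geq_{lex}v\}$ is a lexsegment set, and the ideal $(L(u,v))$ it generates is a lexsegment ideal. For a monomial $w$, $\operatorname{supp}(w)=\{i : x_i\mid w\}$ and $\min(w)=\min\{i : x_i\mid w\}$. For $2\leq j,t\leq n$ with $j\leq t-2$, $P_{j,t}=(x_2,\ldots,x_j,x_t,\ldots,x_n)$. (Under the hypotheses of the proposition, $x_1$ has exponent $1$ in $u$, so that $u=x_1x_l^{a_l}\cdots x_n^{a_n}$ with $l\geq 2$ and $a_l>0$.) *)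

(* Defs.v *)
From mathcomp Require Import all_boot all_order all_algebra.
From mathcomp Require Export mpoly.

Set Implicit Arguments.
Unset Strict Implicit.
Unset Printing Implicit Defensive.

Import Order.TTheory GRing.Theory.
Local Open Scope ring_scope.

(* Ideals are Prop-valued predicates, compared extensionally, since membership *)
(* is not decidable over a general ring.                                       *)
Section Ideals.
Variable R : comNzRingType.
Implicit Types (I P Q G m : R -> Prop) (f g : R).

Definition ideal_eq P Q : Prop := forall f, P f <-> Q f.

Definition is_ideal I : Prop :=
  [/\ I 0, forall f g, I f -> I g -> I (f + g) & forall f g, I g -> I (f * g)].

Definition prime_ideal P : Prop :=
  [/\ is_ideal P, ~ P 1 & forall f g, P (f * g) -> P f \/ P g].

Definition gen_ideal G f : Prop :=
  exists s : seq (R * R),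
    (forall p, p \in s -> G p.2) /\ f = \sum_(p <- s) p.1 * p.2.

(* P \in Ass(R/I): P is prime and is the annihilator of a class f + I of R/I. *)
Definition Ass I P : Prop :=
  prime_ideal P /\ exists f, forall g, P g <-> I (g * f).

(* f_1, ..., f_r is a regular sequence on M = R/I: f_i is a nonzerodivisor on  *)
(* M/(f_1, ..., f_{i-1})M for each i, and M/(f_1, ..., f_r)M is nonzero.       *)
Fixpoint regular_seq I (s : seq R) : Prop :=
  match s with
  | [::] => ~ I 1
  | f :: s' => (forall g, I (f * g) -> I g)
               /\ regular_seq (gen_ideal (fun h => I h \/ h = f)) s'
  end.

(* k is the depth of R/I with respect to m: the maximal length of a regular    *)
(* sequence on R/I with all its terms in m.                                    *)
Definition is_depth m I (k : nat) : Prop :=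
  (exists s, [/\ size s = k, forall f, f \in s -> m f & regular_seq I s])
  /\ (forall s, (forall f, f \in s -> m f) -> regular_seq I s -> (size s <= k)%N).

End Ideals.

Section Monomials.
Variable n : nat.
Implicit Types (u v w : 'X_{1..n}).

(* The library order on 'X_{1..n} is degree-lexicographic; this is the         *)
(* lexicographic order on exponent vectors, with 'X_0 > 'X_1 > ... .           *)
Definition lex_ge u v : bool := ((v : seqlexi nat) <= (u : seqlexi nat))%O.

Definition supp w : {set 'I_n} := [set i | (0 < w i)%N].

Definition is_min w (l : 'I_n) : Prop :=
  l \in supp w /\ forall i, i \in supp w -> (l <= i)%N.

Definition lexsegment (d : nat) u v w : Prop :=
  [/\ mdeg w = d, lex_ge u w & lex_ge w v].

End Monomials.

(* Indices start at 0: the variable x_{i+1} of K[x_1, ..., x_n] is 'X_i.        *)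
Section PolynomialIdeals.
Variables (K : fieldType) (n : nat).
Local Notation S := {mpoly K[n]}.

Definition lexsegment_ideal (d : nat) (u v : 'X_{1..n}) : S -> Prop :=
  gen_ideal (fun f : S => exists2 w, lexsegment d u v w & f = 'X_[w]).

Definition var_ideal (A : pred 'I_n) : S -> Prop :=
  gen_ideal (fun f : S => exists2 i, A i & f = 'X_i).

Definition max_ideal : S -> Prop := var_ideal predT.

(* (x_1, ..., x_j), for the 0-based index j *)
Definition initial_ideal (j : nat) : S -> Prop :=
  var_ideal (fun i => (i <= j)%N).

(* P_{j,t} = (x_2, ..., x_j, x_t, ..., x_n), for the 0-based indices j and t *)
Definition P_ideal (j t : nat) : S -> Prop :=
  var_ideal (fun i => (0 < i <= j)%N || (t <= i)%N).

(* (x_2, ..., x_n) *)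
Definition tail_ideal : S -> Prop := var_ideal (fun i => (0 < i)%N).

Definition depth_quot (I : S -> Prop) (k : nat) : Prop :=
  is_depth max_ideal I k.

End PolynomialIdeals.

Arguments initial_ideal K n j f : clear implicits.
Arguments P_ideal K n j t f : clear implicits.
Arguments tail_ideal K n f : clear implicits.
Arguments lexsegment_ideal K {n} d u v f.

(* Main.v *)
Require Import Defs.
From mathcomp Require Import all_boot all_order all_algebra.
From mathcomp Require Import zify ring.
From Stdlib Require Import Classical.

Set Implicit Arguments.
Unset Strict Implicit.
Unset Printing Implicit Defensive.

Import Order.TTheory GRing.Theory.
Local Open Scope ring_scope.

(** Indices start at 0, and [u = x_0 u'] with [u' = x_l^(a_l) ...].

    For a monomial ideal [I], every associated prime is [I : t] for a monomial
    [t], and is generated by variables ([Ass_mono_ideal]).  So the problem is to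
    find the sets [A] of variables such that the monomials multiplying some [t]
    into [I] are exactly those divisible by a variable of [A] ([colon_vars]).

    If the depth is positive, no [t] outside [I] is killed by all the variables;
    applied to [u'], this shows that [x_0] divides [u] only once
    ([exponent_first]).  Then [I = L + x_0 F] ([lexseg_monoE]), where [L] is the
    ideal of the initial lexsegment of the monomials without [x_0] down to [v],
    and [F] that of the final lexsegment of degree [d - 1] starting at [u'].
    Membership in both is easy to test: a monomial of degree at least [d] lies
    in [L] when its exponent vector is lexicographically at least that of [v],
    and membership in [F] depends only on the exponents from [x_l] on.

    Let [I : t] be generated by the variables of [A], and suppose that some
    variable other than [x_0] is not in [A].  Multiplying [t] by a high power of
    the variables outside [A] keeps [I : t], and makes the degree of [t] large.
    As [t] is not in [L], it falls below [v] at some index [j] of the support of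
    [v], and the variables that bring it into [L] are [x_1, ..., x_j].  If [x_0]
    is in [A], this gives [(x_0, ..., x_j)].  Otherwise [t] is also outside [F],
    which forces the variables beyond [x_l] into [A], whereas those strictly
    between [x_j] and [x_l] stay outside; according to whether [x_l] is in [A],
    this is [P_{j,l}] or [P_{j,l+1}], and the latter is impossible when
    [u' = x_l^(d-1)] ([colon_cases]).  Conversely, all these primes occur: take
    [v] truncated at [x_j] and divided by [x_j], times high powers of the
    variables to be left out, times a socle monomial of [F] in the last
    variables ([colon_initial], [colon_P]).

    There remains the prime [(x_1, ..., x_n)], which is associated exactly when
    the depth is 1.  If it is associated, then the depth is at most the
    dimension 1 of its quotient ([depth_le1]).  An explicit [t] shows that it is
    associated as soon as the support of [v] contains an index from [l - 1] on
    ([colon_tail]).  If it is not associated, then the support of [v] ends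
    before [l - 1], and [x_(l-1), x_0 + x_n] is a regular sequence
    ([regular_pair]).  In particular, for depth greater than 1 the bounds on [j]
    in [P_{j,l}] and [P_{j,l+1}] hold automatically. *)

(** * Ideals and regular sequences *)

Section IdealTheory.
Variable R : comNzRingType.
Implicit Types (I J P G T : R -> Prop) (a b e f g x : R).

Lemma idealB I f g : is_ideal I -> I f -> I g -> I (f - g).
Proof.
by case=> _ ID IM If Ig; apply: ID => //; rewrite -mulN1r; apply: IM.
Qed.

Lemma idealMr I f g : is_ideal I -> I f -> I (f * g).
Proof. by case=> _ _ IM If; rewrite mulrC; apply: IM. Qed.

Lemma ideal_sum I (T : eqType) (r : seq T) (F : T -> R) :
  is_ideal I -> (forall i, i \in r -> I (F i)) -> I (\sum_(i <- r) F i).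
Proof.
case=> I0 ID _ IF; rewrite big_seq.
by apply: (big_ind I) => // i; apply: IF.
Qed.

Lemma gen_ideal_is_ideal G : is_ideal (gen_ideal G).
Proof.
split; first by exists [::]; rewrite big_nil.
- move=> f g [s [Gs ->]] [s' [Gs' ->]]; exists (s ++ s'); rewrite big_cat.
  by split=> // p; rewrite mem_cat => /orP[/Gs|/Gs'].
- move=> f g [s [Gs ->]]; exists [seq (f * p.1, p.2) | p <- s]; split.
    by move=> _ /mapP[p sp ->] /=; apply: Gs.
  by rewrite big_map mulr_sumr; apply: eq_bigr => p _; rewrite mulrA.
Qed.

Lemma gen_ideal_gen G f : G f -> gen_ideal G f.
Proof.
by move=> Gf; exists [:: (1, f)]; rewrite big_seq1 mul1r; split=> // p; rewrite inE => /eqP->.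
Qed.

Lemma gen_ideal_min G I :
  is_ideal I -> (forall f, G f -> I f) -> forall f, gen_ideal G f -> I f.
Proof.
move=> idI GI f [s [Gs ->]]; apply: ideal_sum => // p sp.
by case: idI => _ _; apply; apply: GI; apply: Gs.
Qed.

Lemma gen_adjoinP I f h :
  is_ideal I ->
  gen_ideal (fun h => I h \/ h = f) h <-> exists z, I (h - f * z).
Proof.
move=> idI; split=> [|[z Iz]]; last first.
  have [_ JD JM] := gen_ideal_is_ideal (fun h => I h \/ h = f).
  rewrite -(subrK (f * z) h); apply: JD; first by apply: gen_ideal_gen; left.
  by rewrite mulrC; apply: JM; apply: gen_ideal_gen; right.
have [I0 ID IM] := idI.
apply: (gen_ideal_min (I := fun h => exists z, I (h - f * z))) => {h}.
  split; first by exists 0; rewrite mulr0 subr0.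
  - move=> g h [y Iy] [z Iz]; exists (y + z).
    have -> : g + h - f * (y + z) = (g - f * y) + (h - f * z) by ring.
    exact: ID.
  - move=> g h [z Iz]; exists (g * z).
    have -> : g * h - f * (g * z) = g * (h - f * z) by ring.
    exact: IM.
move=> h [Ih|->]; first by exists 0; rewrite mulr0 subr0.
by exists 1; rewrite mulr1 subrr.
Qed.

Lemma Ass_ext I J P :
  ideal_eq I J -> Ass I P <-> Ass J P.
Proof.
move=> eqIJ; split=> -[prP [f Pf]]; split=> //; exists f => g.
  by rewrite Pf; apply: eqIJ.
by rewrite Pf; split=> /eqIJ.
Qed.

Lemma Ass_ideal_eq I P Q :
  ideal_eq P Q -> Ass I P -> Ass I Q.
Proof.
move=> eqPQ [[[P0 PD PM] P1 Pm] [f Pf]]; split; last first.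
  by exists f => g; rewrite -Pf; split=> /eqPQ.
split; first split.
- exact/eqPQ.
- by move=> g h /eqPQ Pg /eqPQ Ph; apply/eqPQ; apply: PD.
- by move=> g h /eqPQ Ph; apply/eqPQ; apply: PM.
- by move/eqPQ.
- by move=> g h /eqPQ /Pm[] /eqPQ; [left|right].
Qed.

Lemma regular_seq_ext I J s : ideal_eq I J -> regular_seq I s -> regular_seq J s.
Proof.
elim: s I J => [|f s IHs] I J eqIJ /=; first by move=> I1 /eqIJ.
move=> [regf regs]; split=> [g /eqIJ /regf /eqIJ //|].
apply: IHs regs => h; split; (apply: gen_ideal_min; first exact: gen_ideal_is_ideal);
  by move=> h' [/eqIJ|] Hh; apply: gen_ideal_gen; [left|right].
Qed.

Lemma is_depth_ext m I J k : ideal_eq I J -> is_depth m I k -> is_depth m J k.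
Proof.
move=> eqIJ [[s [szs ms regs]] maxk]; split.
  by exists s; split=> //; apply: regular_seq_ext regs.
by move=> s' ms' /regular_seq_ext regs'; apply: maxk ms' (regs' _ _) => f; split=> /eqIJ.
Qed.

(** If [b] is nilpotent modulo [I], then [b ^+ k.+1 * g] and [(a + b) * g] in
    [I] give [a * (b ^+ k * g)] in [I], so the exponent of [b] comes down to
    zero one step at a time. *)
Lemma regular_add_nilpotent I a b N g :
  is_ideal I -> (forall h, I (a * h) -> I h) -> I (b ^+ N) ->
  I ((a + b) * g) -> I g.
Proof.
move=> idI rega nilb Iabg; have [_ _ IM] := idI.
have: I (b ^+ N * g) by apply: idealMr.
elim: N {nilb} => [|N IHN]; first by rewrite expr0 mul1r.
move=> IbS; apply: IHN; apply: rega.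
have -> : a * (b ^+ N * g) = b ^+ N * ((a + b) * g) - b ^+ N.+1 * g.
  by rewrite exprS; ring.
by apply: idealB => //; apply: IM.
Qed.

(** The elements of [R/I] killed by [T] form a module [N] over [R/T], on which
    every element of [(x) + T] acts as a multiple of [x].  If [e] in [N] is not
    in [x N] and [f1] acts as [x * h1], then [h1 * e] is killed by [f2] modulo
    [f1], while regularity of [f1] keeps it out of [f1 * (R/I)].  This is the
    bound of the depth by the dimension of [R/T], in dimension one. *)
Lemma no_regular_seq2 I T x e h1 r1 h2 r2 s :
  is_ideal I -> T r1 -> T r2 ->
  (forall r, T r -> I (r * e)) ->
  (forall z, (forall r, T r -> I (r * z)) -> ~ I (e - x * z)) ->
  ~ regular_seq I [:: x * h1 + r1, x * h2 + r2 & s].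
Proof.
move=> idI Tr1 Tr2 Ne ndiv /= [reg1 [reg2 _]]; have [_ ID IM] := idI.
set f1 := x * h1 + r1 in reg1 reg2.
have /reg2 /(gen_adjoinP _ _ idI)[z Iz] :
    gen_ideal (fun h => I h \/ h = f1) ((x * h2 + r2) * (h1 * e)).
  apply/gen_adjoinP => //; exists (h2 * e).
  have -> : (x * h2 + r2) * (h1 * e) - f1 * (h2 * e)
            = h1 * (r2 * e) - h2 * (r1 * e) by rewrite /f1; ring.
  by apply: idealB => //; apply: IM; apply: Ne.
apply: (ndiv z) => [r Tr|]; apply: reg1.
  have -> : f1 * (r * z) = h1 * (r * e) - r * (h1 * e - f1 * z) by ring.
  by apply: idealB => //; apply: IM => //; apply: Ne.
have -> : f1 * (e - x * z) = x * (h1 * e - f1 * z) + r1 * e by rewrite /f1; ring.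
by apply: ID; [apply: IM|apply: Ne].
Qed.

End IdealTheory.

(** * Monomial ideals and their associated primes *)

Section MonomialIdeals.
Variables (K : fieldType) (n : nat).
Local Notation S := {mpoly K[n]}.
Implicit Types (D Q : pred 'X_{1..n}) (A : pred 'I_n) (m s t w : 'X_{1..n}).
Implicit Types (f g : S) (P : S -> Prop).

Definition up_closed D := forall m m', D m -> D (m + m')%MM.

Definition mono_ideal D f : Prop := forall m, m \in msupp f -> D m.

Definition var_mono A m := [exists i, A i && (0 < m i)%N].

(** In terms of the monomial ideal [I] of [D], this is
    [I : t = (x_i : i in A)]. *)
Definition colon_vars D t A := forall m, D (m + t)%MM = var_mono A m.

Lemma var_monoP A m : reflect (exists2 i, A i & (0 < m i)%N) (var_mono A m).
Proof.
by apply: (iffP existsP) => [[i /andP[]]|[i Ai mi]]; exists i => //; apply/andP.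
Qed.

Lemma up_closed_le D m m' : up_closed D -> (m <= m')%MM -> D m -> D m'.
Proof. by move=> upD /submK <- Dm; rewrite addmC; apply: upD. Qed.

Lemma up_closed_var A : up_closed (var_mono A).
Proof.
move=> m m' /var_monoP[i Ai mi]; apply/var_monoP; exists i => //.
by rewrite mnmDE addn_gt0 mi.
Qed.

Lemma mono_ideal_eq D Q : D =1 Q -> ideal_eq (mono_ideal D) (mono_ideal Q).
Proof. by move=> eqDQ f; split=> If m /If; rewrite eqDQ. Qed.

Lemma mono_ideal_is_ideal D : up_closed D -> is_ideal (mono_ideal D).
Proof.
move=> upD; split; first by move=> m; rewrite msupp0.
- move=> f g If Ig m /msuppD_le; rewrite mem_cat => /orP[/If|/Ig] //.
- move=> f g Ig m /msuppM_le /allpairsP[[m1 m2] /= [_ /Ig Dm2 ->]].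
  by rewrite addmC; apply: upD.
Qed.

Lemma mono_idealX D m : mono_ideal D ('X_[m] : S) <-> D m.
Proof.
split=> [|Dm m']; first by apply; rewrite msuppX inE.
by rewrite msuppX inE => /eqP->.
Qed.

Lemma mono_idealMX D f t :
  mono_ideal D (f * 'X_[t]) <-> mono_ideal (fun m => D (m + t)%MM) f.
Proof.
split=> If m fm.
  by apply: If; rewrite (perm_mem (msuppMX _ _)) addmC map_f.
move: fm; rewrite (perm_mem (msuppMX _ _)) => /mapP[m' fm' ->].
by rewrite addmC; apply: If.
Qed.

Lemma mono_sub_ideal D P :
  is_ideal P -> (forall m, D m -> P 'X_[m]) -> forall f, mono_ideal D f -> P f.
Proof.
move=> idP DP f If; rewrite (mpolyE f); apply: ideal_sum => // m fm.
by case: idP => _ _ PM; rewrite -mul_mpolyC; apply: PM; apply/DP/If.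
Qed.

Lemma gen_mono_idealE (G : 'X_{1..n} -> Prop) D :
  (forall m, D m <-> exists2 w, G w & (w <= m)%MM) ->
  ideal_eq (gen_ideal (fun f : S => exists2 w, G w & f = 'X_[w])) (mono_ideal D).
Proof.
move=> DE f.
have upD : up_closed D.
  move=> m m' /DE[w Gw le_wm]; apply/DE; exists w => //.
  by apply: lepm_trans le_wm _; apply: lem_addr.
split.
  apply: gen_ideal_min; first exact: mono_ideal_is_ideal.
  by move=> _ [w Gw ->]; apply/mono_idealX/DE; exists w => //; apply: lepm_refl.
apply: mono_sub_ideal; first exact: gen_ideal_is_ideal.
move=> m /DE[w Gw /submK <-]; rewrite mpolyXD.
have [_ _ JM] := gen_ideal_is_ideal (fun f : S => exists2 w, G w & f = 'X_[w]).
by apply: JM; apply: gen_ideal_gen; exists w.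
Qed.

Lemma var_idealE A : ideal_eq (var_ideal (K := K) A) (mono_ideal (var_mono A)).
Proof.
have /(@gen_mono_idealE _) E : forall m, var_mono A m <->
    exists2 w, (exists2 i, A i & w = U_(i)%MM) & (w <= m)%MM.
  move=> m; split=> [/var_monoP[i Ai mi]|[_ [i Ai ->]]].
    by exists U_(i)%MM; [exists i|rewrite lep1mP -lt0n].
  by rewrite lep1mP -lt0n => mi; apply/var_monoP; exists i.
move=> f; rewrite -E; split; apply: gen_ideal_min.
- exact: gen_ideal_is_ideal.
- by move=> _ [i Ai ->]; apply: gen_ideal_gen; exists U_(i)%MM => //; exists i.
- exact: gen_ideal_is_ideal.
- by move=> _ [_ [i Ai ->] ->]; apply: gen_ideal_gen; exists i.
Qed.

Lemma var_ideal_ext A B :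
  A =1 B -> ideal_eq (var_ideal (K := K) A) (var_ideal B).
Proof.
move=> eqAB f; rewrite !var_idealE; apply: mono_ideal_eq => m.
by apply: eq_existsb => i; rewrite eqAB.
Qed.

(** The remainder [g] is [f] without its terms that lie in the ideal. *)
Lemma mono_reduce D f :
  exists g, mono_ideal D (f - g) /\ msupp g =i [seq m <- msupp f | ~~ D m].
Proof.
pose g := \sum_(m <- msupp f | ~~ D m) f@_m *: 'X_[m].
have gE m : g@_m = if D m then 0 else f@_m.
  rewrite raddf_sum /= big_seq_cond.
  under eq_bigr do rewrite mcoeffZ mcoeffX.
  have [Dm|nDm] := boolP (D m).
    rewrite big1 // => m' /andP[_ nDm'].
    by case: eqP => [eqm|_]; [rewrite eqm Dm in nDm'|rewrite mulr0].
  have [fm|nfm] := boolP (m \in msupp f).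
    rewrite -big_seq_cond big_mkcond (bigD1_seq m) ?msupp_uniq //= nDm eqxx mulr1.
    by rewrite big1 ?addr0 // => m' /negPf->; rewrite mulr0 if_same.
  rewrite (memN_msupp_eq0 nfm) big1 // => m' /andP[fm' _].
  by case: eqP => [eqm|_]; [rewrite eqm (negPf nfm) in fm'|rewrite mulr0].
exists g; split=> m; rewrite ?mem_filter mcoeff_msupp ?mcoeffB gE.
  by case: (D m) => //; rewrite subrr eqxx.
by case: (D m); rewrite ?eqxx // mcoeff_msupp.
Qed.

Lemma var_ideal_prime A : prime_ideal (var_ideal (K := K) A).
Proof.
have idV := gen_ideal_is_ideal (fun f : S => exists2 i, A i & f = 'X_i).
split=> //.
  move/var_idealE/(_ 0%MM); rewrite mcoeff_msupp mcoeff1 eqxx oner_eq0.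
  by move=> /(_ isT) /var_monoP[i _]; rewrite mnm0E.
move=> f g /var_idealE Vfg.
have idI := mono_ideal_is_ideal (@up_closed_var A); have [_ _ IM] := idI.
have [f' [If' sf']] := mono_reduce (var_mono A) f.
have [g' [Ig' sg']] := mono_reduce (var_mono A) g.
have Vfg' : mono_ideal (var_mono A) (f' * g').
  have -> : f' * g' = f * g - (f - f') * g - f' * (g - g') by ring.
  apply: (idealB idI _ (IM _ _ Ig')).
  exact: (idealB idI Vfg (idealMr _ idI If')).
have [f0|nzf] := eqVneq f' 0; first by left; apply/var_idealE; rewrite -[f]subr0 -f0.
have [g0|nzg] := eqVneq g' 0; first by right; apply/var_idealE; rewrite -[g]subr0 -g0.
have := mlead_supp nzf; rewrite sf' mem_filter => /andP[nVf _].
have := mlead_supp nzg; rewrite sg' mem_filter => /andP[nVg _].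
have /Vfg' : mlead (f' * g') \in msupp (f' * g').
  by apply: mlead_supp; rewrite mulf_neq0.
rewrite mleadM // => /var_monoP[i Ai]; rewrite mnmDE addn_gt0.
by case/orP=> mi; [case/negP: nVf|case/negP: nVg]; apply/var_monoP; exists i.
Qed.

Lemma prime_mono_var P m :
  prime_ideal P -> P 'X_[m] -> exists2 i, (0 < m i)%N & P 'X_i.
Proof.
move=> [_ P1 Pm]; move: {2}(mdeg m) (erefl (mdeg m)) => k.
elim: k m => [|k IHk] m.
  by move/eqP; rewrite mdeg_eq0 => /eqP->; rewrite mpolyX0.
move=> degm PX.
have [i mi] : exists i, (0 < m i)%N.
  apply/existsP; apply: contraT => /existsPn m0.
  have : mdeg m = 0%N; last by rewrite degm.
  by rewrite mdegE big1 // => i _; apply/eqP; rewrite -leqn0 leqNgt.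
have le1 : (U_(i) <= m)%MM by rewrite lep1mP -lt0n.
move: PX; rewrite -{1}(submK le1) mpolyXD => /Pm[] PX; last by exists i.
have [|j mj Pj] := IHk _ _ PX.
  by move: degm; rewrite -{1}(submK le1) mdegD mdeg1 addn1 => -[].
by exists j => //; move: mj; rewrite mnmBE subn_gt0; apply: leq_trans.
Qed.

(** Choose [f] with [P = I : f] and as few terms as possible.  A monomial [a]
    outside [P] can be multiplied into [f], so minimality forces it to kill
    either no term of [f] or all of them: all the terms [m] of [f] have the
    same [I : m].  Comparing leading terms then shows that this common
    monomial ideal is [P], and a prime monomial ideal is generated by
    variables. *)
Theorem Ass_mono_ideal D P :
  up_closed D ->
  Ass (mono_ideal D) P <->
  exists t A, colon_vars D t A /\ ideal_eq P (var_ideal (K := K) A).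
Proof.
move=> upD; have idI := mono_ideal_is_ideal upD; have [I0 ID IM] := idI.
split=> [|[t [A [colA eqPA]]]]; last first.
  apply: (@Ass_ideal_eq _ _ (var_ideal A)) => [f|]; first by split=> /eqPA.
  split; first exact: var_ideal_prime.
  exists 'X_[t] => g; rewrite mono_idealMX var_idealE.
  by apply: mono_ideal_eq => m; rewrite colA.
move=> [prP [f Pf]]; have [idlP P1 Pm] := prP; have [P0 PD PM] := idlP.
move: {2}(size (msupp f)) (leqnn (size (msupp f))) => N.
elim: N f Pf => [|N IHN] f Pf szf.
  case: P1; apply/Pf; rewrite mul1r (msuppnil0 (p := f)) //.
  by apply/nilP; rewrite /nilp -leqn0.
(* A monomial [a] outside [P] that kills a term of [f]: by primality, [a * f]
   without the terms in the ideal still has the annihilator [P]. *)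
have [[a [m [fm Dam nPa]]]|uniform] :=
  classic (exists a m, [/\ m \in msupp f, D (a + m)%MM & ~ P 'X_[a]]).
  have [g [Ig sg]] := mono_reduce D (f * 'X_[a]).
  apply: (IHN g) => [h|].
    have -> : mono_ideal D (h * g) <-> mono_ideal D (h * 'X_[a] * f).
      have e1 : h * 'X_[a] * f = h * (f * 'X_[a] - g) + h * g by ring.
      have e2 : h * g = h * 'X_[a] * f - h * (f * 'X_[a] - g) by ring.
      by split=> H; [rewrite e1; apply: ID|rewrite e2; apply: (idealB idI)] => //; apply: IM.
    by rewrite -Pf; split=> [/(idealMr _ idlP)|/Pm[]].
  rewrite -ltnS; apply: leq_trans szf.
  pose s := [seq m <- msupp f | ~~ D (a + m)%MM].
  have le_gs : (size (msupp g) <= size s)%N.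
    rewrite -(size_map (fun m => a + m)%MM s); apply: uniq_leq_size; first exact: msupp_uniq.
    move=> m'; rewrite sg mem_filter (perm_mem (msuppMX _ _)).
    case/andP=> nD /mapP[m'' fm'' Em]; apply/mapP; exists m'' => //.
    by rewrite mem_filter fm'' -Em nD.
  apply: leq_ltn_trans le_gs _; rewrite size_filter.
  rewrite -[size (msupp f)](count_predC (fun m => ~~ D (a + m)%MM)).
  by rewrite -addn1 leq_add2l -has_count; apply/hasP; exists m => //=; rewrite negbK.
have nzf : f != 0.
  by apply/eqP => f0; case: P1; apply/Pf; rewrite f0 mulr0.
pose t := mlead f; pose Q m := D (m + t)%MM.
have QP a : Q a -> P 'X_[a].
  move=> Qa; apply: NNPP => nPa; case: uniform.
  by exists a, t; split=> //; apply: mlead_supp.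
have upQ : up_closed Q.
  by move=> m m' Qm; rewrite /Q -addmA (addmC m') addmA; apply: upD.
have PQ : ideal_eq P (mono_ideal Q).
  move=> g; split=> [Pg|]; last exact: mono_sub_ideal.
  have [g' [Ig' sg']] := mono_reduce Q g.
  have [g0|nzg] := eqVneq g' 0; first by rewrite -[g]subr0 -g0.
  have : P g'.
    have -> : g' = g - (g - g') by ring.
    exact: (idealB idlP Pg (mono_sub_ideal idlP QP Ig')).
  have := mlead_supp nzg; rewrite sg' mem_filter => /andP[nQ _].
  move/Pf=> Igf; case/negP: nQ; rewrite /Q -mleadM //; apply: Igf.
  by apply: mlead_supp; rewrite mulf_neq0.
pose A i := Q U_(i)%MM.
have QA : Q =1 var_mono A.
  move=> m; apply/idP/idP => [/QP /(prime_mono_var prP)[i mi Pi]|/var_monoP[i Ai mi]].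
    by apply/var_monoP; exists i => //; apply/(mono_idealX Q)/PQ.
  by apply: up_closed_le Ai => //; rewrite lep1mP -lt0n.
exists t, A; split=> [m|g]; first exact: QA.
by rewrite PQ var_idealE; apply: mono_ideal_eq.
Qed.

(** As [D] is closed under multiples, it is enough to test the variables of [A]
    and the monomials prime to them. *)
Lemma colon_varsI D t A :
  up_closed D -> (forall i, A i -> D (U_(i) + t)%MM) ->
  (forall s, (forall i, A i -> s i = 0%N) -> ~~ D (s + t)%MM) ->
  colon_vars D t A.
Proof.
move=> upD DA nD m; apply/idP/var_monoP => [Dm|[i Ai mi]].
  apply/var_monoP; apply: contraTT Dm => /existsPn Am.
  apply: nD => i Ai; apply/eqP; rewrite -leqn0 leqNgt.
  by move: (Am i); rewrite Ai.
apply: up_closed_le (DA i Ai) => //; apply/mnm_lepP => j.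
rewrite !mnmDE mnm1E leq_add2r; case: eqP => // <-; exact: mi.
Qed.

Lemma colon_varsD D t A s :
  colon_vars D t A -> (forall i, A i -> s i = 0%N) -> colon_vars D (s + t)%MM A.
Proof.
move=> colA s0 m; rewrite addmA colA.
by apply/var_monoP/var_monoP => -[i Ai mi]; exists i => //; move: mi; rewrite mnmDE (s0 i Ai) addn0.
Qed.

Lemma colon_vars1 D t A i : colon_vars D t A -> D (U_(i) + t)%MM = A i.
Proof.
move=> ->; apply/var_monoP/idP => [[j Aj]|Ai]; last by exists i; rewrite ?mnm1E ?eqxx.
by rewrite mnm1E; case: eqP => [->|].
Qed.

Lemma colon_vars0 D t A : colon_vars D t A -> ~~ D t.
Proof.
move=> colA; rewrite -[t]add0m colA; apply/var_monoP => -[i _].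
by rewrite mnm0E.
Qed.

Lemma colon_vars_ext D t A B : A =1 B -> colon_vars D t A -> colon_vars D t B.
Proof.
by move=> eqAB colA m; rewrite colA; apply: eq_existsb => i; rewrite eqAB.
Qed.

Lemma var_ideal_kill D t A r :
  up_closed D -> (forall i, A i -> D (U_(i) + t)%MM) ->
  var_ideal (K := K) A r -> mono_ideal D (r * 'X_[t]).
Proof.
move=> upD Dt /var_idealE Vr; apply/mono_idealMX => m /Vr /var_monoP[i Ai mi].
apply: up_closed_le (Dt i Ai) => //; apply/mnm_lepP => j; rewrite !mnmDE mnm1E leq_add2r.
by case: eqP => // <-.
Qed.

Lemma adjoin_varE D p :
  up_closed D ->
  ideal_eq (gen_ideal (fun h : S => mono_ideal D h \/ h = 'X_p))
           (mono_ideal (fun m => D m || (0 < m p)%N)).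
Proof.
move=> upD; pose E : pred 'X_{1..n} := fun m => D m || (0 < m p)%N.
have upE : up_closed E.
  move=> m m' /orP[/upD Dm|mp]; rewrite /E ?Dm // orbC.
  by rewrite mnmDE addn_gt0 mp.
move=> f; split.
  apply: gen_ideal_min => [|h [Ih m /Ih Dm|->]]; first exact: mono_ideal_is_ideal.
    by rewrite Dm.
  by apply/(mono_idealX E); rewrite /E mnm1E eqxx orbT.
have idG := gen_ideal_is_ideal (fun h : S => mono_ideal D h \/ h = 'X_p).
apply: mono_sub_ideal => // m /orP[Dm|mp].
  by apply: gen_ideal_gen; left; apply/mono_idealX.
have le1 : (U_(p) <= m)%MM by rewrite lep1mP -lt0n.
rewrite -(submK le1) mpolyXD; case: idG => _ _; apply.
by apply: gen_ideal_gen; right.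
Qed.

Definition socle_free D := forall t, (forall i, D (U_(i) + t)%MM) -> D t.

(** A monomial outside [I] that is multiplied into [I] by all the variables
    makes every element of the maximal ideal a zero divisor modulo [I]. *)
Lemma depth_gt0_no_socle D k :
  up_closed D -> depth_quot (mono_ideal D) k -> (0 < k)%N -> socle_free D.
Proof.
move=> upD [[[|f s] [<- max_s reg]] _] // _ t Dt.
apply/mono_idealX; case: reg => regf _; apply: regf.
by apply: var_ideal_kill (max_s f (mem_head _ _)) => // i _; apply: Dt.
Qed.

End MonomialIdeals.

Section FirstVariable.
Variables (K : fieldType) (n : nat).
Local Notation S := {mpoly K[n.+1]}.
Implicit Types (D : pred 'X_{1..n.+1}) (t : 'X_{1..n.+1}) (f r z : S).

Lemma max_ideal_split f :
  max_ideal f -> exists h r, f = 'X_ord0 * h + r /\ var_ideal (fun i : 'I_n.+1 => 0 < i)%N r.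
Proof.
set T := var_ideal _; have [T0 TD TM] : is_ideal T := gen_ideal_is_ideal _.
apply: (gen_ideal_min (I := fun f => exists h r, f = 'X_ord0 * h + r /\ T r)) => [|_ [i _ ->]].
  split=> [|_ _ [h [r [-> Tr]]] [h' [r' [-> Tr']]]|f' _ [h [r [-> Tr]]]].
  - by exists 0, 0; rewrite mulr0 addr0.
  - by exists (h + h'), (r + r'); split; [ring|apply: TD].
  - by exists (f' * h), (f' * r); split; [ring|apply: TM].
have [i0|i0] := posnP i.
  exists 1, 0; rewrite mulr1 addr0 (_ : i = ord0) //; exact: val_inj.
by exists 0, 'X_i; rewrite mulr0 add0r; split=> //; apply: gen_ideal_gen; exists i.
Qed.

(** The other variables generate a prime whose quotient is the polynomial ring
    in [x_0], of dimension 1, so [no_regular_seq2] applies, with [x_0] for [x].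
    It needs an element killed by this prime that is not [x_0 z] for another such
    element [z]: dividing [t] by [x_0] as long as the quotient is still killed by
    the other variables leads to one, since the ideal is monomial. *)
Theorem depth_le1 D k t :
  up_closed D -> depth_quot (K := K) (mono_ideal D) k -> ~~ D t ->
  (forall i : 'I_n.+1, (0 < i)%N -> D (U_(i) + t)%MM) -> (k <= 1)%N.
Proof.
move=> upD [[s [<- max_s reg]] _].
case: s max_s reg => [|f1 [|f2 s]] // max_s reg nDt Dt; exfalso.
have [N] := ubnP (t ord0); elim: N t nDt Dt => // N IHN t nDt Dt tN.
have [/andP[t0 /forallP Dt']|minimal] := boolP ((0 < t ord0)%N &&
    [forall i : 'I_n.+1, (0 < i)%N ==> D (U_(i) + (t - U_(ord0)))%MM]).
  have le1 : (U_(ord0) <= t)%MM by rewrite lep1mP -lt0n.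
  apply: (IHN (t - U_(ord0))%MM) => [|i i0|]; last by rewrite mnmBE mnm1E eqxx; lia.
    by apply: contra nDt => Dt0; rewrite -(submK le1); apply: upD.
  exact: implyP (Dt' i) i0.
have [h1 [r1 [Ef1 Tr1]]] := max_ideal_split (max_s f1 (mem_head _ _)).
have [h2 [r2 [Ef2 Tr2]]] : exists h r,
    f2 = 'X_ord0 * h + r /\ var_ideal (fun i : 'I_n.+1 => 0 < i)%N r.
  by apply/max_ideal_split/max_s; rewrite !inE eqxx orbT.
move: reg; rewrite Ef1 Ef2; apply: (@no_regular_seq2 _ _ _ _ ('X_[t])) Tr1 Tr2 _ _.
- exact: mono_ideal_is_ideal.
- by move=> r; apply: var_ideal_kill.
move=> z Nz Iz.
have : t \notin msupp ('X_[t] - 'X_ord0 * z) by apply: contra nDt => /Iz.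
rewrite -mcoeff_eq0 mcoeffB mcoeffX eqxx subr_eq0 mulrC => /eqP coef_t.
have : t \in msupp (z * 'X_ord0) by rewrite mcoeff_msupp -coef_t oner_eq0.
rewrite (perm_mem (msuppMX _ _)) => /mapP[m zm tE].
case/negP: minimal; rewrite {1}tE mnmDE mnm1E eqxx; apply/forallP => i; apply/implyP => i0.
rewrite tE [(U_(ord0) + m)%MM]addmC addmK addmC.
have Ti : var_ideal (fun i : 'I_n.+1 => 0 < i)%N ('X_i : S).
  by apply: gen_ideal_gen; exists i.
by move: (Nz _ Ti); rewrite mulrC => /mono_idealMX /(_ _ zm).
Qed.

End FirstVariable.

(** * The lexicographic order *)

Section LexOrder.
Variable n : nat.
Implicit Types (a b c m u v w : 'X_{1..n}) (i j : 'I_n) (k : nat).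

(** The strict lexicographic order on the exponents of index at least [k]:
    [k = 0] gives the order of all the monomials, [k = 1] that of the monomials
    without the first variable. *)
Definition lex_lt_from k a b :=
  [exists j : 'I_n, [&& (k <= j)%N, (a j < b j)%N
                     & [forall i : 'I_n, (k <= i < j)%N ==> (a i == b i)]]].

Lemma lex_lt_fromP k a b :
  reflect (exists j, [/\ (k <= j)%N, (a j < b j)%N
                       & forall i, (k <= i < j)%N -> a i = b i])
          (lex_lt_from k a b).
Proof.
apply: (iffP existsP) => -[j].
  by case/and3P=> kj ab /forallP E; exists j; split=> // i ij; apply/eqP; apply: (implyP (E i)).
case=> kj ab E; exists j; apply/and3P; split=> //.
by apply/forallP => i; apply/implyP => /E ->.
Qed.

Lemma lex_lt_from_total k a b :
  ~~ lex_lt_from k a b ->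
  (forall i, (k <= i)%N -> a i = b i) \/ lex_lt_from k b a.
Proof.
move=> nlt; pose d i := (k <= i)%N && (a i != b i).
have [/existsP[i0 di0]|/existsPn nd] := boolP [exists i, d i]; last first.
  by left=> i ki; apply/eqP; move: (nd i); rewrite /d ki negbK.
right; case: (arg_minnP (fun i : 'I_n => i : nat) di0) => j /andP[kj nab] jmin.
have agree i : (k <= i < j)%N -> a i = b i.
  case/andP=> ki ij; apply/eqP; apply: contraTT ij => nabi.
  by rewrite -leqNgt; apply: jmin; rewrite /d ki.
have [lab|lba|/eqP] := ltngtP (a j) (b j); last by rewrite (negPf nab).
  by case/lex_lt_fromP: nlt; exists j.
by apply/lex_lt_fromP; exists j; split=> // i /agree.
Qed.

(** Domination before [p] is enough instead of agreement: a first difference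
    before [p] can only be in favour of [a] as well. *)
Lemma lex_lt_fromN k a b (p : 'I_n) :
  (forall i, (k <= i < p)%N -> (b i <= a i)%N) -> (k <= p)%N -> (b p < a p)%N ->
  ~~ lex_lt_from k a b.
Proof.
move=> dom kp abp; apply/lex_lt_fromP => -[j [kj abj agree]].
have [jp|pj|/val_inj pj] := ltngtP j p.
- by move: (dom j); rewrite kj jp leqNgt abj => /(_ isT).
- by move: (agree p); rewrite kp pj => /(_ isT) E; rewrite E ltnn in abp.
- by move: abp; rewrite -pj ltnNge (ltnW abj).
Qed.

Lemma lex_lt_fromN_le k a b :
  (forall i, (k <= i)%N -> (b i <= a i)%N) -> ~~ lex_lt_from k a b.
Proof.
by move=> dom; apply/lex_lt_fromP => -[j [kj abj _]]; move: (dom j kj); rewrite leqNgt abj.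
Qed.

Lemma lex_lt_from_mono k a a' b :
  (forall i, (k <= i)%N -> (a i <= a' i)%N) ->
  lex_lt_from k a' b -> lex_lt_from k a b.
Proof.
move=> le_aa'; apply: contraTT => /lex_lt_from_total[eq_ab|].
  by apply: lex_lt_fromN_le => i ki; rewrite -eq_ab ?le_aa'.
case/lex_lt_fromP=> p [kp lt_p agree]; apply: (lex_lt_fromN (p := p)) => //.
  by move=> i /andP[ki ip]; rewrite agree ?ki // le_aa'.
exact: leq_trans lt_p (le_aa' p kp).
Qed.

Lemma lex_geE u w : lex_ge u w = ~~ lex_lt_from 0 u w.
Proof.
rewrite /lex_ge leNgt; congr (~~ _).
have -> : ((u : seqlexi nat) < (w : seqlexi nat))%O
        = ((u : n.-tuplelexi nat) < (w : n.-tuplelexi nat))%O by [].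
apply/ltxi_tuplePlt/lex_lt_fromP => -[j].
  move=> agree lt_j; exists j; split=> [//|//|i ij].
  by rewrite !mnm_tnth; apply: agree.
case=> _ lt_j agree; exists j; first by move=> i ij; rewrite -!mnm_tnth; apply: agree.
by rewrite -!mnm_tnth.
Qed.

Lemma lex_ge_refl u : lex_ge u u.
Proof. by rewrite /lex_ge. Qed.

Lemma lex_ge_trans v u w : lex_ge u v -> lex_ge v w -> lex_ge u w.
Proof. by rewrite /lex_ge => vu wv; apply: le_trans wv vu. Qed.

Lemma lex_ge_prefix a b i :
  lex_ge a b -> (forall j, (j < i)%N -> a j = b j) -> (b i <= a i)%N.
Proof.
rewrite lex_geE => nlt agree; rewrite leqNgt; apply: contra nlt => lt_i.
by apply/lex_lt_fromP; exists i; split.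
Qed.

Lemma lex_ge_zeros a b k :
  lex_ge a b -> (forall i, (i < k)%N -> a i = 0%N) -> forall i, (i < k)%N -> b i = 0%N.
Proof.
move=> ge_ab a0 i; have [N] := ubnP (i : nat); elim: N i => // N IHN i iN ik.
apply/eqP; rewrite -leqn0 -(a0 i ik); apply: lex_ge_prefix ge_ab _ => j ji.
by rewrite a0 ?IHN //; lia.
Qed.

Lemma mdeg_le a b : (forall i, (a i <= b i)%N) -> (mdeg a <= mdeg b)%N.
Proof. by move=> le_ab; rewrite !mdegE; apply: leq_sum. Qed.

Lemma mdeg_lt a b j :
  (forall i, (a i <= b i)%N) -> (a j < b j)%N -> (mdeg a < mdeg b)%N.
Proof.
move=> le_ab lt_j; rewrite !mdegE (bigD1 j) // [X in (_ < X)%N](bigD1 j) //=.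
by rewrite -addSn; apply: leq_add => //; apply: leq_sum.
Qed.

(** Deleting variables of [m] one at a time, beyond the index where [m] first
    exceeds [v] if possible, keeps [m] at least [v] until its degree has come
    down to that of [v]. *)
Lemma lex_ge_truncate v m :
  lex_ge m v -> (mdeg v <= mdeg m)%N ->
  exists w, [/\ (w <= m)%MM, mdeg w = mdeg v & lex_ge w v].
Proof.
move: {2}(mdeg m - mdeg v)%N (erefl (mdeg m - mdeg v)%N) => e.
elim: e m => [|e IHe] m dege ge_mv le_vm.
  by exists m; split; rewrite ?lepm_refl //; lia.
have [le_v|nle_v] := boolP (v <= m)%MM; first by exists v; split; rewrite ?lex_ge_refl.
suff [q mq ge_q] : exists2 q, (0 < m q)%N & lex_ge (m - U_(q))%MM v.
  have le1 : (U_(q) <= m)%MM by rewrite lep1mP -lt0n.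
  have degq : (mdeg (m - U_(q)) + 1 = mdeg m)%N by rewrite -{2}(submK le1) mdegD mdeg1.
  have [|//||w [le_w dw gew]] := IHe (m - U_(q))%MM; [lia|lia|].
  by exists w; split=> //; apply: lepm_trans le_w (lem_subr _ _).
move: ge_mv; rewrite lex_geE => /lex_lt_from_total[eq_mv|/lex_lt_fromP[j [_ lt_j agree]]].
  by case/mnm_lepP: nle_v => i; rewrite eq_mv.
have [/existsP[q /andP[jq mq]]|/existsPn none] :=
  boolP [exists q : 'I_n, (j < q)%N && (0 < m q)%N].
  exists q => //; rewrite lex_geE; apply: (@lex_lt_fromN _ _ _ j) => // [i ij|].
    by rewrite mnmBE mnm1E agree //; case: (eqVneq q i) => [qi|_] /=; [subst q; lia|lia].
  by rewrite mnmBE mnm1E; case: (eqVneq q j) => [qj|_] /=; [subst q; lia|lia].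
(* As [m] ends at [j], the first index where [m - U_(j)] could fall below [v]
   lies beyond [j], and would make its degree smaller than that of [v]. *)
exists j; first lia.
rewrite lex_geE; apply/lex_lt_fromP => -[p [_ lt_p agree']].
have jp : (j < p)%N.
  rewrite ltnNge; apply/negP; rewrite leq_eqVlt => /orP[/eqP/val_inj pj|pj].
    by move: lt_p; rewrite pj mnmBE mnm1E eqxx; lia.
  by move: lt_p; rewrite mnmBE mnm1E agree //; case: (eqVneq j p) => [jp|_] /=; [subst p; lia|lia].
have le_v : forall i, ((m - U_(j))%MM i <= v i)%N.
  move=> i; have [ip|pi] := ltnP i p; first by rewrite agree'.
  have [ij|ji|ij] := ltngtP i j.
  - by rewrite mnmBE agree // leq_subr.
  - by rewrite mnmBE; move: (none i); rewrite ji /=; lia.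
  - by move: pi; rewrite leqNgt ij jp.
have le1 : (U_(j) <= m)%MM by rewrite lep1mP -lt0n; lia.
have: (mdeg (m - U_(j)) < mdeg v)%N by apply: mdeg_lt lt_p.
by rewrite -(ltn_add2r 1) -{1}(mdeg1 j) -mdegD submK //; lia.
Qed.

End LexOrder.

(** * Monomials of a lexsegment ideal *)

Section TailDegree.
Variable n : nat.
Implicit Types (m : 'X_{1..n.+1}) (i j : 'I_n.+1).

Definition tail_deg m := (\sum_(i | i != ord0) m i)%N.

Lemma mdeg_tail m : mdeg m = (m ord0 + tail_deg m)%N.
Proof. by rewrite mdegE (bigD1 ord0). Qed.

Lemma tail_degD m m' : tail_deg (m + m') = (tail_deg m + tail_deg m')%N.
Proof. by rewrite -big_split; apply: eq_bigr => i _; rewrite mnmDE. Qed.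

Lemma tail_deg1 i : tail_deg U_(i) = (i != ord0).
Proof. by have := mdeg1 i; rewrite mdeg_tail mnm1E; case: (i == ord0) => /=; lia. Qed.

Lemma tail_deg_ge m i : (0 < i)%N -> (m i <= tail_deg m)%N.
Proof. by move=> i0; rewrite /tail_deg (bigD1 i) ?leq_addr //; case: eqP i0 => // ->. Qed.

Lemma tail_deg_le m m' :
  (forall i, (0 < i)%N -> (m i <= m' i)%N) -> (tail_deg m <= tail_deg m')%N.
Proof. by move=> le_mm'; apply: leq_sum => i; rewrite -lt0n; apply: le_mm'. Qed.

Lemma mdeg_ge m i : (m i <= mdeg m)%N.
Proof. by rewrite mdegE (bigD1 i) ?leq_addr. Qed.

Lemma mdeg_ge2 m i j : i != j -> (m i + m j <= mdeg m)%N.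
Proof.
by move=> ij; rewrite mdegE (bigD1 i) // (bigD1 j) 1?eq_sym //= addnA leq_addr.
Qed.

End TailDegree.

Section Lexsegment.
Variables (n d : nat) (u v : 'X_{1..n.+1}).
Implicit Types (m s t w : 'X_{1..n.+1}) (i j p q : 'I_n.+1) (A : pred 'I_n.+1).

Definition lexseg_mono : pred 'X_{1..n.+1} := fun m =>
  [exists w : 'X_{1..n.+1 < d.+1},
     [&& mdeg w == d, lex_ge u w, lex_ge w v & ((w : 'X_{1..n.+1}) <= m)%MM]].

Lemma lexseg_monoP m :
  lexseg_mono m <-> exists2 w, lexsegment d u v w & (w <= m)%MM.
Proof.
split=> [/existsP[w /and4P[/eqP dw uw wv wm]]|[w [dw uw wv] wm]]; first by exists w.
have lt_w : (mdeg w < d.+1)%N by rewrite dw.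
by apply/existsP; exists (BMultinom lt_w); rewrite /= dw eqxx uw wv.
Qed.

Lemma lexseg_mono_up : up_closed lexseg_mono.
Proof.
move=> m m' /lexseg_monoP[w Lw wm]; apply/lexseg_monoP; exists w => //.
exact: lepm_trans wm (lem_addr _ _).
Qed.

Lemma lexsegment_idealE (K : fieldType) :
  ideal_eq (lexsegment_ideal K d u v) (mono_ideal lexseg_mono).
Proof. exact/gen_mono_idealE/lexseg_monoP. Qed.

Lemma lexseg_mono_deg m : lexseg_mono m -> (d <= mdeg m)%N.
Proof. by case/lexseg_monoP=> w [<- _ _] /submK <-; rewrite mdegD leq_addl. Qed.

Definition quo0 := (u - U_(ord0))%MM.

(** If [x_0] divides [u] only once, the generators divisible by [x_0] are the
    multiples by [x_0] of a final lexsegment of degree [d - 1]; this is the ideal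
    of that lexsegment. *)
Definition final_mono : pred 'X_{1..n.+1} := fun m =>
  [exists w : 'X_{1..n.+1 < d.+1},
     [&& mdeg w == (d - 1)%N, lex_ge quo0 w & ((w : 'X_{1..n.+1}) <= m)%MM]].

Lemma final_monoP m :
  reflect (exists w, [/\ mdeg w = (d - 1)%N, lex_ge quo0 w & (w <= m)%MM])
          (final_mono m).
Proof.
apply: (iffP existsP) => [[w /and3P[/eqP dw uw wm]]|[w [dw uw wm]]]; first by exists w.
have lt_w : (mdeg w < d.+1)%N by rewrite dw; lia.
by exists (BMultinom lt_w); rewrite /= dw eqxx uw.
Qed.

(** The ideal of the initial lexsegment ending at [v] in the variables other
    than [x_0]: for a monomial of degree at least [d], comparing its largest
    divisor of degree [d] with [v] amounts to comparing its exponents with those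
    of [v]. *)
Definition initial_mono : pred 'X_{1..n.+1} := fun m =>
  (d <= tail_deg m)%N && ~~ lex_lt_from 1 m v.

Lemma initial_mono_mono m m' :
  (forall i, (0 < i)%N -> (m i <= m' i)%N) -> initial_mono m -> initial_mono m'.
Proof.
move=> le_mm' /andP[dm nlt]; apply/andP; split.
  exact: leq_trans dm (tail_deg_le le_mm').
by apply: contra nlt; apply: lex_lt_from_mono.
Qed.

Hypotheses (d_ge2 : (2 <= d)%N) (deg_u : mdeg u = d).

(** If [x_0] divides [u] twice, then [u / x_0] times any variable is between
    [u] and [v], so [u / x_0] is killed by all the variables. *)
Lemma exponent_first :
  (0 < u ord0)%N -> v ord0 = 0%N ->
  socle_free lexseg_mono ->
  u ord0 = 1%N.
Proof.
move=> u0 v0 no_socle; apply/eqP; rewrite eqn_leq u0 andbT leqNgt; apply/negP => u2.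
have le1 : (U_(ord0) <= u)%MM by rewrite lep1mP -lt0n.
have deg_h : (mdeg quo0 + 1 = d)%N by rewrite -(mdeg1 (ord0 : 'I_n.+1)) -mdegD submK.
suff /no_socle /lexseg_mono_deg : forall i, lexseg_mono (U_(i) + quo0)%MM by lia.
move=> i; apply/lexseg_monoP; exists (U_(i) + quo0)%MM; last exact: lepm_refl.
split; first by rewrite mdegD mdeg1; lia.
  have [->|i0] := eqVneq i ord0; first by rewrite addmC submK // lex_ge_refl.
  rewrite lex_geE; apply: (@lex_lt_fromN _ 0 u _ ord0) => //.
  by rewrite !mnmE (negPf i0) eqxx; lia.
rewrite lex_geE; apply: (@lex_lt_fromN _ 0 _ v ord0) => //.
by rewrite v0 !mnmE eqxx; lia.
Qed.

Hypothesis (u0 : u ord0 = 1%N).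

Lemma quo0_first : quo0 ord0 = 0%N.
Proof. by rewrite mnmBE mnm1E u0. Qed.

Lemma quo0_deg : mdeg quo0 = (d - 1)%N.
Proof.
have le1 : (U_(ord0) <= u)%MM by rewrite lep1mP u0.
by rewrite -deg_u -{1}(submK le1) mdegD mdeg1 addnK.
Qed.

(** * The final part *)

Variable l : 'I_n.+1.
Hypothesis (min_l : is_min quo0 l).

Lemma quo0_l_gt0 : (0 < quo0 l)%N.
Proof. by case: min_l; rewrite inE. Qed.

Lemma quo0_lt i : (i < l)%N -> quo0 i = 0%N.
Proof.
case: min_l => _ minl il; apply/eqP; rewrite -leqn0 leqNgt; apply/negP => hi.
by have := minl i; rewrite inE hi => /(_ isT); rewrite leqNgt il.
Qed.

Lemma l_gt0 : (0 < l)%N.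
Proof.
have [l0|//] := posnP l; move: quo0_l_gt0.
by rewrite (_ : l = ord0) ?quo0_first //; apply: val_inj.
Qed.

Lemma le_quo0_lt w i : lex_ge quo0 w -> (i < l)%N -> w i = 0%N.
Proof. by move=> ge; apply: lex_ge_zeros ge _ _ => j; apply: quo0_lt. Qed.

Lemma le_quo0_l w : lex_ge quo0 w -> (w l <= quo0 l)%N.
Proof.
by move=> ge; apply: lex_ge_prefix (ge) _ => j jl; rewrite quo0_lt // (le_quo0_lt ge).
Qed.

Lemma le_quo0I w : (forall i, (i < l)%N -> w i = 0%N) -> (w l < quo0 l)%N -> lex_ge quo0 w.
Proof.
move=> w0 wl; rewrite lex_geE; apply: (@lex_lt_fromN _ 0 _ _ l) => // i il.
by rewrite w0.
Qed.

Lemma final_mono_ge m m' :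
  (forall i, (l <= i)%N -> (m i <= m' i)%N) -> final_mono m -> final_mono m'.
Proof.
move=> le_mm' /final_monoP[w [dw uw /mnm_lepP wm]]; apply/final_monoP; exists w; split=> //.
apply/mnm_lepP => i; have [li|il] := leqP l i; last by rewrite (le_quo0_lt uw).
exact: leq_trans (wm i) (le_mm' i li).
Qed.

(** The monomial [x_i x_n^(d-2)] is the least one of its degree divisible by
    [x_i]; for [i >= l] it is at most [u / x_0], which starts with [x_l]. *)
Lemma final_mono_last i :
  (l <= i)%N -> final_mono (U_(i) + U_(ord_max) *+ (d - 2))%MM.
Proof.
move=> li; apply/final_monoP; exists (U_(i) + U_(ord_max) *+ (d - 2))%MM.
have deg_w : mdeg (U_(i) + U_(ord_max) *+ (d - 2))%MM = (d - 1)%N.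
  by rewrite mdegD mdegMn !mdeg1; lia.
split=> //; last exact: lepm_refl.
set w := (_ + _)%MM in deg_w *.
rewrite lex_geE; apply/lex_lt_fromP => -[j [_ lt_j agree]].
have [jn|jn] := eqVneq j ord_max.
  have : (mdeg quo0 < mdeg w)%N; last by rewrite deg_w quo0_deg ltnn.
  apply: (mdeg_lt (j := j)) => // k; have [kn|kn] := eqVneq k ord_max.
    by rewrite kn -jn ltnW.
  rewrite agree //= jn; have := ltn_ord k; rewrite ltnS leq_eqVlt => /orP[/eqP kn'|//].
  by case/eqP: kn; apply: val_inj.
have wE k : k != ord_max -> w k = (i == k).
  by move=> kn; rewrite mnmDE mulmnE !mnm1E [ord_max == k]eq_sym (negPf kn) addn0.
move: lt_j; rewrite wE //; case: eqP => [ij|_] //=; rewrite ltnS leqn0 => /eqP hj.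
have lj : (l < j)%N.
  rewrite ltn_neqAle -ij li andbT; apply: contraTneq quo0_l_gt0 => /val_inj ->.
  by rewrite ij hj.
have ln : l != ord_max.
  apply: contraTneq lj => ->; rewrite -leqNgt; have := ltn_ord j; rewrite ltnS.
  by [].
have := agree l lj; rewrite wE // => hl; have := quo0_l_gt0; rewrite hl ij.
by case: eqP => // jl; rewrite jl ltnn in lj.
Qed.

Lemma final_mono_gt i m : (l < i)%N -> (d <= m i)%N -> final_mono m.
Proof.
move=> li dm; apply/final_monoP; exists (U_(i) *+ (d - 1))%MM.
have wE k : (U_(i) *+ (d - 1))%MM k = ((i == k) * (d - 1))%N by rewrite mulmnE mnm1E.
split; first by rewrite mdegMn mdeg1 mul1n.
  apply: le_quo0I => [k kl|]; rewrite wE.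
    by case: (eqVneq i k) => [ik|] //; subst k; lia.
  by case: (eqVneq i l) => [il|_]; [subst i; lia|rewrite quo0_l_gt0].
by apply/mnm_lepP => k; rewrite wE; case: (eqVneq i k) => [<-|] //=; lia.
Qed.

Lemma final_mono_quo0 m : quo0 l = (d - 1)%N -> (d <= m l)%N -> final_mono m.
Proof.
move=> hl dm; apply/final_monoP; exists quo0; split; rewrite ?quo0_deg ?lex_ge_refl //.
apply/mnm_lepP => k; have [->|kl] := eqVneq k l; first by rewrite hl; lia.
by have := mdeg_ge2 quo0 kl; rewrite quo0_deg hl; lia.
Qed.

(** A monomial [g] in the variables from [x_c] on whose class is killed by
    exactly these variables modulo the final monomials, once the variables from
    [x_l] to [x_(c-1)] are inverted. *)
Definition final_socle (c : nat) (g : 'X_{1..n.+1}) :=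
  [/\ forall q, (q < c)%N -> g q = 0%N,
      forall i m, (c <= i)%N -> (forall q, (c <= q)%N -> ((U_(i) + g)%MM q <= m q)%N) ->
        (forall q, (l <= q < c)%N -> (d <= m q)%N) -> final_mono m
    & forall m, (forall q, (c <= q)%N -> (m q <= g q)%N) -> ~~ final_mono m].

Lemma final_socle_last : final_socle l (U_(ord_max) *+ (d - 2))%MM.
Proof.
split=> [q ql|i m li le_m _|m le_m].
- rewrite mulmnE mnm1E; case: (eqVneq ord_max q) => [qn|] //.
  by subst q; have := ltn_ord l; rewrite ltnS leqNgt ql.
- exact: final_mono_ge (final_mono_last li).
- apply/final_monoP => -[w [dw uw /mnm_lepP wm]].
  have : (mdeg w <= mdeg (U_(ord_max : 'I_n.+1) *+ (d - 2)))%N; last first.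
    by rewrite mdegMn mdeg1 dw; lia.
  apply: mdeg_le => q; have [lq|ql] := leqP l q; last by rewrite (le_quo0_lt uw).
  exact: leq_trans (wm q) (le_m q lq).
Qed.

Lemma l_not_last : (quo0 l < d - 1)%N -> (l < n)%N.
Proof.
move=> hl; have := ltn_ord l; rewrite ltnS leq_eqVlt => /orP[/eqP ln|//].
suff : (mdeg quo0 <= mdeg (U_(l) *+ quo0 l))%N by rewrite mdegMn mdeg1 quo0_deg; lia.
apply: mdeg_le => q; rewrite mulmnE mnm1E; case: (eqVneq l q) => [<-|lq]; first by rewrite mul1n.
by rewrite quo0_lt //; move: lq (ltn_ord q); rewrite -val_eqE /=; lia.
Qed.

(** With [e = d - 1 - a_l], the power [x_(l+1)^e] is the largest monomial of
    its degree in the variables after [x_l].  Any monomial of larger degree is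
    final once [x_l] is inverted, so if [x_(l+1)^e] is not final, it is in the
    socle.  If it is, so are all the monomials of degree [e], and then
    [x_(l+1)^(e-1)] is in the socle. *)
Lemma final_socle_next : (quo0 l < d - 1)%N -> exists g, final_socle l.+1 g.
Proof.
move=> hl; have ln := l_not_last hl.
pose r : 'I_n.+1 := Ordinal (ln : (l.+1 < n.+1)%N).
have lr : l != r by rewrite -val_eqE /= neq_ltn ltnSn.
have lr0 : (l == r) = false by exact: negbTE.
have rl0 : (r == l) = false by rewrite eq_sym.
pose e := (d - 1 - quo0 l)%N.
have rE k q : (U_(r) *+ k)%MM q = ((r == q) * k)%N by rewrite mulmnE mnm1E.
have lE k q : (U_(l) *+ k)%MM q = ((l == q) * k)%N by rewrite mulmnE mnm1E.
have r0 k q : (q < l.+1)%N -> (U_(r) *+ k)%MM q = 0%N.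
  by move=> ql; rewrite rE; case: (eqVneq r q) => [rq|] //; subst q; rewrite ltnn in ql.
have le_upto_l w q : (forall i, (i < l)%N -> w i = 0%N) -> (q <= l)%N ->
    (w l <= (U_(l) *+ quo0 l)%MM l)%N -> (w q <= (U_(l) *+ quo0 l)%MM q)%N.
  move=> w0; rewrite leq_eqVlt => /orP[/eqP/val_inj->//|ql _].
  by rewrite w0.
have [X|nX] := boolP (final_mono (U_(l) *+ d + U_(r) *+ e)%MM).
  exists (U_(r) *+ (e - 1))%MM.
  have ge_w : lex_ge quo0 (U_(l) *+ quo0 l + U_(r) *+ e)%MM.
    case/final_monoP: X => w [dw uw /mnm_lepP wm].
    suff <- : w = (U_(l) *+ quo0 l + U_(r) *+ e)%MM by [].
    have le_w q : (w q <= (U_(l) *+ quo0 l + U_(r) *+ e)%MM q)%N.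
      have := wm q; rewrite !mnmDE !lE rE; case: (eqVneq l q) => [<-|] //= _.
      by rewrite rl0 mul1n addn0 le_quo0_l.
    have deg_w : mdeg (U_(l) *+ quo0 l + U_(r) *+ e)%MM = mdeg w.
      by rewrite mdegD !mdegMn !mdeg1 dw; lia.
    apply/mnmP => q; apply/eqP; rewrite eqn_leq le_w leqNgt; apply/negP => lt_q.
    by have := mdeg_lt le_w lt_q; rewrite deg_w ltnn.
  split=> [q ql|i m li le_m dm|m le_m]; first exact: r0.
  - have il0 : (i == l) = false by apply/negP => /eqP il; subst i; rewrite ltnn in li.
    apply/final_monoP; exists (U_(l) *+ quo0 l + (U_(i) + U_(r) *+ (e - 1)))%MM; split.
    + by rewrite !mdegD !mdegMn !mdeg1; lia.
    + apply: lex_ge_trans ge_w _; rewrite lex_geE; apply/lex_lt_fromP => -[j [_]].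
      rewrite !mnmDE !lE !rE mnm1E => lt_j agree.
      have ij : i = j.
        by apply/eqP; apply: contraTT lt_j => /negPf->; rewrite -leqNgt; lia.
      subst j; have ri : (r < i)%N.
        rewrite ltn_neqAle li andbT; apply: contraTN lt_j => /eqP/val_inj ri.
        by rewrite -ri eqxx lr0 -leqNgt; lia.
      have := agree r ri; rewrite !mnmDE !lE !rE mnm1E eqxx.
      by case: (eqVneq i r) => [ir|_]; [subst i; rewrite ltnn in ri|rewrite lr0; lia].
    + apply/mnm_lepP => q; have [lq|ql] := leqP l.+1 q.
        apply: leq_trans (le_m q lq); rewrite mnmDE lE.
        by case: (eqVneq l q) => [E|_] //; subst q; rewrite ltnn in lq.
      rewrite mnmDE [(U_(i) + _)%MM q]mnmDE r0 // lE mnm1E.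
      have [iq|_] := eqVneq i q; first by subst q; rewrite ltnNge li in ql.
      have [lq|_] := eqVneq l q; last by [].
      by subst q; have := dm l; rewrite leqnn ltnSn => /(_ isT); lia.
  - apply/final_monoP => -[w [dw uw /mnm_lepP wm]].
    suff : (mdeg w <= mdeg (U_(l) *+ quo0 l + U_(r) *+ (e - 1)))%N.
      by rewrite dw mdegD !mdegMn !mdeg1; lia.
    apply: mdeg_le => q; rewrite mnmDE; have [lq|ql] := leqP l.+1 q.
      by apply: leq_trans (wm q) (leq_trans (le_m q lq) _); rewrite leq_addl.
    apply: leq_trans (leq_addr _ _); apply: le_upto_l => //.
      by move=> i; apply: le_quo0_lt.
    by rewrite lE eqxx mul1n le_quo0_l.
exists (U_(r) *+ e)%MM; split=> [q ql|i m li le_m dm|m le_m]; first exact: r0.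
- have il0 : (i == l) = false by apply/negP => /eqP il; subst i; rewrite ltnn in li.
  have hl0 := quo0_l_gt0.
  apply/final_monoP; exists (U_(l) *+ (quo0 l - 1) + (U_(i) + U_(r) *+ e))%MM; split.
  + by rewrite !mdegD !mdegMn !mdeg1; lia.
  + apply: le_quo0I => [q ql|].
      rewrite !mnmDE lE r0 1?ltnW // mnm1E.
      have [iq|_] := eqVneq i q; first by subst q; lia.
      by have [lq|_] := eqVneq l q; first by subst q; rewrite ltnn in ql.
    by rewrite !mnmDE lE r0 // mnm1E il0 eqxx; lia.
  + apply/mnm_lepP => q; have [lq|ql] := leqP l.+1 q.
      apply: leq_trans (le_m q lq); rewrite mnmDE lE.
      by case: (eqVneq l q) => [E|_] //; subst q; rewrite ltnn in lq.
    rewrite mnmDE [(U_(i) + _)%MM q]mnmDE r0 // lE mnm1E.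
    have [iq|_] := eqVneq i q; first by subst q; rewrite ltnNge li in ql.
    have [lq|_] := eqVneq l q; last by [].
    by subst q; have := dm l; rewrite leqnn ltnSn => /(_ isT); lia.
- apply: contra nX => /final_monoP[w [dw uw /mnm_lepP wm]].
  apply/final_monoP; exists w; split=> //; apply/mnm_lepP => q.
  rewrite mnmDE; have [lq|ql] := leqP l.+1 q.
    by apply: leq_trans (wm q) (leq_trans (le_m q lq) _); rewrite leq_addl.
  rewrite r0 // addn0 lE; have [E|lq] := eqVneq l q.
    by subst q; have := le_quo0_l uw; lia.
  by rewrite (le_quo0_lt uw) // ltn_neqAle -ltnS ql andbT eq_sym.
Qed.

(** * The two parts of a lexsegment ideal *)

Hypotheses (v0 : v ord0 = 0%N) (deg_v : mdeg v = d).

(** A generator of the ideal is either [x_0 w] with [w <= u / x_0], or lies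
    between [v] and the first monomial without [x_0]. *)
Lemma lexseg_monoE m :
  lexseg_mono m = initial_mono m || (0 < m ord0)%N && final_mono m.
Proof.
apply/idP/idP.
  case/lexseg_monoP=> w [dw uw wv] /mnm_lepP wm.
  have [w0|w0] := posnP (w ord0).
    apply/orP; left; apply: (@initial_mono_mono w) => //.
    rewrite /initial_mono -dw mdeg_tail w0 leqnn /=.
    move: wv; rewrite lex_geE; apply: contra => /lex_lt_fromP[j [j0 lt_j agree]].
    apply/lex_lt_fromP; exists j; split=> // i ij.
    have [i0|i0] := posnP i; last by apply: agree; rewrite i0; case/andP: ij.
    by rewrite (_ : i = ord0) ?w0 ?v0 //; apply: val_inj.
  have w1 : w ord0 = 1%N.
    by apply/eqP; rewrite eqn_leq w0 andbT -u0; apply: lex_ge_prefix uw _.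
  apply/orP; right; rewrite (leq_trans w0 (wm _)).
  have le1 : (U_(ord0) <= w)%MM by rewrite lep1mP w1.
  apply/final_monoP; exists (w - U_(ord0))%MM; split.
  - by rewrite -dw -{2}(submK le1) mdegD mdeg1 addnK.
  - move: uw; rewrite !lex_geE; apply: contra => /lex_lt_fromP[j [j0 lt_j agree]].
    apply/lex_lt_fromP; exists j; split=> // [|i ij].
      by move: lt_j; rewrite !mnmE; lia.
    have := agree i ij; rewrite !mnmE; case: (eqVneq ord0 i) => [<-|_] /=; last lia.
    by rewrite u0 w1.
  - by apply/mnm_lepP => i; rewrite mnmBE (leq_trans (leq_subr _ _)).
case/orP=> [/andP[dm nlt]|/andP[m0 /final_monoP[w [dw uw /mnm_lepP wm]]]]; last first.
  have w0 : w ord0 = 0%N.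
    by apply/eqP; rewrite -leqn0 -quo0_first; apply: lex_ge_prefix uw _.
  apply/lexseg_monoP; exists (U_(ord0) + w)%MM; last first.
    apply/mnm_lepP => i; rewrite mnmDE mnm1E.
    by case: (eqVneq ord0 i) => [<-|_] /=; [rewrite w0|apply: wm].
  split; first by rewrite mdegD mdeg1 dw; lia.
    move: uw; rewrite !lex_geE; apply: contra => /lex_lt_fromP[j [j0 lt_j agree]].
    apply/lex_lt_fromP; exists j; split=> // [|i ij].
      by move: lt_j; rewrite !mnmE; case: (eqVneq ord0 j) => [<-|_] /=; rewrite ?u0 ?w0; lia.
    have := agree i ij; rewrite !mnmE; case: (eqVneq ord0 i) => [<-|_] /=; last lia.
    by rewrite u0 w0.
  rewrite lex_geE; apply: (@lex_lt_fromN _ 0 _ v ord0) => //.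
  by rewrite v0 !mnmE eqxx; lia.
pose m' := [multinom if i == ord0 then 0%N else m i | i < n.+1].
have m'0 : m' ord0 = 0%N by rewrite mnmE eqxx.
have m'S i : (0 < i)%N -> m' i = m i by rewrite mnmE; case: eqP => // ->.
have [||w [wm' dw wv]] := @lex_ge_truncate _ v m'.
- rewrite lex_geE; apply: contra nlt => /lex_lt_fromP[j [_ lt_j agree]].
  have j0 : (0 < j)%N.
    have [j0|//] := posnP j; move: lt_j.
    by rewrite (_ : j = ord0) ?m'0 ?v0 //; apply: val_inj.
  apply/lex_lt_fromP; exists j; split=> [//||i /andP[i0 ij]].
    by rewrite -m'S.
  by rewrite -m'S // agree.
- rewrite deg_v mdeg_tail m'0 (leq_trans dm) //.
  by apply: tail_deg_le => i i0; rewrite m'S.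
apply/lexseg_monoP; exists w.
  split; rewrite ?dw // lex_geE.
  apply: (@lex_lt_fromN _ 0 _ _ ord0) => //.
  by move/mnm_lepP: wm' => /(_ ord0); rewrite m'0 u0; lia.
apply: lepm_trans wm' _; apply/mnm_lepP => i; rewrite mnmE.
by case: eqP.
Qed.

(** * The associated primes *)

Definition P_vars (j c : nat) : pred 'I_n.+1 := fun i => (0 < i <= j)%N || (c <= i)%N.
Definition initial_vars (j : nat) : pred 'I_n.+1 := fun i => (i <= j)%N.
Definition tail_vars : pred 'I_n.+1 := fun i => (0 < i)%N.

Lemma supp_v_gt0 j : j \in supp v -> (0 < j)%N.
Proof.
rewrite inE => vj; have [j0|//] := posnP j.
by move: vj; rewrite (_ : j = ord0) ?v0 //; apply: val_inj.
Qed.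

Lemma v_le q : (v q <= d)%N.
Proof. by rewrite -deg_v mdeg_ge. Qed.

Lemma not_initial_mono j m :
  (0 < j)%N -> (m j < v j)%N -> (forall q, (0 < q < j)%N -> m q = v q) ->
  ~~ initial_mono m.
Proof.
by move=> j0 lt_j agree; rewrite negb_and negbK; apply/orP; right; apply/lex_lt_fromP; exists j.
Qed.

(** For [i < j] the product first differs from [v] at [x_i]; for [i = j] it is
    at least [v] up to [x_j], and the large exponent at [x_p] decides. *)
Lemma initial_mono_bump i j p t :
  (forall q, (0 < q < j)%N -> v q = t q) -> (v j <= (t j).+1)%N ->
  p = j.+1 :> nat -> (d < t p)%N -> (0 < i <= j)%N ->
  initial_mono (U_(i) + t)%MM.
Proof.
move=> agree vj pj tp /andP[i0 ij]; have p0 : (0 < p)%N by rewrite pj.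
apply/andP; split.
  rewrite tail_degD; apply: leq_trans (leq_addl _ _).
  exact: leq_trans (ltnW tp) (tail_deg_ge _ p0).
move: ij; rewrite leq_eqVlt => /orP[/eqP/val_inj ij|ij].
  apply: (@lex_lt_fromN _ 1 _ v p) => // [q|]; last first.
    by rewrite mnmDE (leq_trans _ (leq_addl _ _)) // (leq_ltn_trans (v_le p)).
  rewrite pj ltnS => /andP[q0]; rewrite leq_eqVlt mnmDE mnm1E ij.
  case/orP=> [/eqP/val_inj->|qj]; first by rewrite eqxx.
  by rewrite agree ?q0 // leq_addl.
apply: (@lex_lt_fromN _ 1 _ v i) => // [q /andP[q0 qi]|].
  by rewrite agree ?q0 ?(ltn_trans qi) // mnmDE leq_addl.
by rewrite mnmDE mnm1E eqxx agree ?i0.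
Qed.

(** The witness is [v] truncated at [x_j] and divided by [x_j], times powers of
    the later variables with exponents larger than those of [v]. *)
Lemma colon_initial j :
  j \in supp v -> j != ord_max -> exists t, colon_vars lexseg_mono t (initial_vars j).
Proof.
move=> sj jn; have j0 := supp_v_gt0 sj; move: sj; rewrite inE => vj.
have ltjn : (j.+1 < n.+1)%N.
  by move: jn (ltn_ord j); rewrite -val_eqE /=; lia.
pose p : 'I_n.+1 := Ordinal ltjn.
pose t := [multinom if i == ord0 then 0%N else if (i < j)%N then v i
                    else if i == j then (v j - 1)%N else d.+1 | i < n.+1].
have t0 : t ord0 = 0%N by rewrite mnmE eqxx.
have t_lt q : (0 < q < j)%N -> t q = v q.
  by case/andP=> q0 qj; rewrite mnmE qj; case: eqP q0 => // ->.
have tj : t j = (v j - 1)%N by rewrite mnmE ltnn eqxx; case: eqP j0 => // ->.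
have t_gt q : (j < q)%N -> t q = d.+1.
  move=> jq; rewrite mnmE; case: eqP jq => [->//|_ jq].
  by rewrite ltnNge ltnW //=; case: eqP jq => // ->; rewrite ltnn.
exists t; apply: colon_varsI => [|i ij|s s0]; first exact: lexseg_mono_up.
  rewrite lexseg_monoE; apply/orP; have [i0|i0] := posnP i; [right|left].
    rewrite (_ : i = ord0); last exact: val_inj.
    rewrite mnmDE mnm1E eqxx /=.
    apply: final_mono_ge (final_mono_last (i := ord_max) (leq_ord l)) => q lq.
    rewrite !mnmDE mulmnE !mnm1E; case: (eqVneq ord_max q) => [<-|_] //=.
    by rewrite t_gt //=; lia.
  apply: (@initial_mono_bump i j p) => // [q /t_lt//|||]; first by rewrite tj; lia.
    by rewrite t_gt.
  by rewrite i0.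
rewrite lexseg_monoE mnmDE s0 // t0 orbF.
apply: (@not_initial_mono j) => // [|q /andP[q0 qj]]; rewrite mnmDE s0 /initial_vars ?leqnn //.
  by rewrite tj; lia.
  by rewrite t_lt ?q0.
exact: ltnW.
Qed.

(** Here the high powers are taken only up to [x_(c-1)], including [x_l] when
    [c = l + 1], and are followed by a monomial that the variables from [x_c] on
    make final.  The factor [x_0] lets the final part count. *)
Lemma colon_P j c g :
  j \in supp v -> (j.+2 <= c)%N -> (l <= c <= l.+1)%N -> final_socle c g ->
  exists t, colon_vars lexseg_mono t (P_vars j c).
Proof.
move=> sj jc /andP[lc cl] [g0 g1 g2]; have j0 := supp_v_gt0 sj; move: sj; rewrite inE => vj.
have ltjn : (j.+1 < n.+1)%N by have := ltn_ord l; lia.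
(* The hypothesis [j.+2 <= c] gives room for at least one high power, at [p]. *)
pose p : 'I_n.+1 := Ordinal ltjn.
pose t := [multinom if i == ord0 then 1%N else if (i < j)%N then v i
                    else if i == j then (v j - 1)%N
                    else if (i < c)%N then d.+1 else g i | i < n.+1].
have t0 : t ord0 = 1%N by rewrite mnmE eqxx.
have t_lt q : (0 < q < j)%N -> t q = v q.
  by case/andP=> q0 qj; rewrite mnmE qj; case: eqP q0 => // ->.
have tj : t j = (v j - 1)%N by rewrite mnmE ltnn eqxx; case: eqP j0 => // ->.
have t_gt q : (j < q)%N -> t q = if (q < c)%N then d.+1 else g q.
  move=> jq; rewrite mnmE; case: eqP jq => [->//|_ jq].
  by rewrite ltnNge ltnW //=; case: eqP jq => // ->; rewrite ltnn.
have t_c q : (c <= q)%N -> t q = g q by move=> cq; rewrite t_gt ?ltnNge ?cq //; lia.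
exists t; apply: colon_varsI => [|i|s s0]; first exact: lexseg_mono_up.
  rewrite lexseg_monoE => /orP[ij|ci]; apply/orP; [left|right].
    apply: (@initial_mono_bump i j p) => // [q /t_lt//||]; first by rewrite tj; lia.
    by rewrite t_gt /= ?jc.
  rewrite mnmDE t0 addn1 /=; apply: (g1 i) => // q; first by move=> cq; rewrite !mnmDE t_c.
  by case/andP=> lq qc; rewrite mnmDE t_gt ?qc; lia.
rewrite lexseg_monoE negb_or negb_and; apply/andP; split; last first.
  apply/orP; right; apply: g2 => q cq.
  by rewrite mnmDE s0 ?t_c // /P_vars cq orbT.
apply: (@not_initial_mono j) => // [|q /andP[q0 qj]]; rewrite mnmDE s0 /P_vars ?leqnn ?j0 //.
  by rewrite tj; lia.
  by rewrite t_lt ?q0.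
by rewrite q0 ltnW.
Qed.

(** Multiplying [t] by high powers of the variables outside [A] does not change
    [I : t].  After that, the only way for [t] to avoid the initial part is to
    fall below [v] at an index [j] before all these variables, and multiplying
    by a variable repairs this exactly up to [x_j].  The final part depends on
    the exponents from [l] on, where it contains high powers of all the
    variables except possibly [x_l]. *)
Theorem colon_cases t A :
  socle_free lexseg_mono ->
  colon_vars lexseg_mono t A ->
  [\/ A =1 tail_vars,
      exists j, [/\ j \in supp v, j != ord_max & A =1 initial_vars j],
      exists j, [/\ j \in supp v, (j.+2 <= l)%N & A =1 P_vars j l]
    | quo0 l <> (d - 1)%N /\
      exists j, [/\ j \in supp v, (j.+1 <= l)%N & A =1 P_vars j l.+1]].
Proof.
move=> no_socle colA.
pose big := [multinom if A i then 0%N else d.+1 | i < n.+1].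
have {colA} : colon_vars lexseg_mono (big + t)%MM A.
  by apply: colon_varsD => // i Ai; rewrite mnmE Ai.
have : forall i, ~~ A i -> (d < (big + t)%MM i)%N.
  by move=> i /negPf nAi; rewrite mnmDE mnmE nAi leq_addr.
move: {t big}(big + t)%MM => t tbig colA.
have killE i : A i = lexseg_mono (U_(i) + t)%MM by rewrite (colon_vars1 _ colA).
have nDt := colon_vars0 colA.
have [/existsP[i0 /andP[i0_gt0 nAi0]]|/existsPn none] :=
  boolP [exists i : 'I_n.+1, (0 < i)%N && ~~ A i]; last first.
  have Apos i : (0 < i)%N -> A i by move=> i0; have := none i; rewrite i0 negbK.
  apply: Or41 => i; rewrite /tail_vars; have [i0|/Apos//] := posnP i.
  apply/negP => Ai; case/negP: nDt; apply: no_socle => q; rewrite -killE.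
  have [q0|/Apos//] := posnP q; rewrite (_ : q = i) //.
  by apply: val_inj; rewrite /= q0 i0.
have dt : (d <= tail_deg t)%N.
  exact: leq_trans (ltnW (tbig _ nAi0)) (tail_deg_ge _ i0_gt0).
move: (nDt); rewrite lexseg_monoE negb_or /initial_mono dt /= negbK => /andP[].
case/lex_lt_fromP=> j [j0 lt_j agree] nfin.
have sj : j \in supp v by rewrite inE; lia.
have out_gt q : (0 < q)%N -> ~~ A q -> (j < q)%N.
  move=> q0 /tbig dq; rewrite ltnNge leq_eqVlt; apply/negP => /orP[/eqP/val_inj qj|qj].
    by have := v_le j; move: lt_j dq; rewrite qj; lia.
  by have := v_le q; move: dq; rewrite agree ?q0 //; lia.
have in_le q : (0 < q <= j)%N -> A q.
  by case/andP=> q0; apply: contraTT => nAq; rewrite -ltnNge out_gt.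
have ji0 := out_gt _ i0_gt0 nAi0.
have not_init q : (j < q)%N -> ~~ initial_mono (U_(q) + t)%MM.
  have bump p : (p < q)%N -> (U_(q) + t)%MM p = t p.
    by move=> pq; rewrite mnmDE mnm1E; case: eqP pq => // ->; rewrite ltnn.
  move=> jq; apply: (@not_initial_mono j) => // [|p /andP[p0 pj]]; first by rewrite bump.
  by rewrite bump ?agree ?p0 // (ltn_trans pj).
have [A0|nA0] := boolP (A ord0).
  (* Here [x_0] does not divide [t], so the other variables can only bring it
     into the initial part. *)
  apply: Or42; exists j; split=> // [|q].
    by apply: contraTneq ji0 => ->; rewrite -leqNgt leq_ord.
  rewrite /initial_vars; have [qj|jq] := leqP q j.
    have [q0|q0] := posnP q; last by rewrite in_le ?q0.
    by rewrite (_ : q = ord0) //; apply: val_inj.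
  have t0 : t ord0 = 0%N.
    apply/eqP; rewrite -leqn0 leqNgt; apply: contra nDt => t0.
    move: A0; rewrite killE !lexseg_monoE t0 /=; case/orP=> [/initial_mono_mono ->//|].
      by move=> i i_gt0; rewrite mnmDE mnm1E; case: eqP i_gt0 => // <-.
    case/andP=> _ fin; apply/orP; right; apply: final_mono_ge fin => i li.
    rewrite mnmDE mnm1E; case: eqP li => // <-.
    by rewrite leqNgt l_gt0.
  rewrite killE lexseg_monoE (negPf (not_init q jq)) /= mnmDE mnm1E t0 addn0.
  by case: eqP jq => // ->.
(* From here on [x_0] divides [t], so [t] is not final. *)
have t0 : (0 < t ord0)%N by apply: leq_ltn_trans (tbig _ nA0).
rewrite t0 /= in nfin.
have A_gt q : (l < q)%N -> A q.
  by move=> lq; apply: contraNT nfin => /tbig dq; apply: final_mono_gt lq _; apply: ltnW.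
have nA_mid q : (j < q < l)%N -> ~~ A q.
  case/andP=> jq ql; rewrite killE lexseg_monoE negb_or not_init //= negb_and orbC.
  apply/orP; left; apply: contra nfin; apply: final_mono_ge => i li.
  by rewrite mnmDE mnm1E; case: eqP ql => // ->; rewrite ltnNge li.
have i0l : (i0 <= l)%N by rewrite leqNgt; apply: contra nAi0; apply: A_gt.
have [Al|nAl] := boolP (A l).
  have il : (i0 < l)%N by rewrite ltn_neqAle i0l andbT; apply: contraNneq nAi0 => /val_inj->.
  apply: Or43; exists j; split=> // [|q]; first exact: leq_ltn_trans ji0 il.
  rewrite /P_vars; have [lq|ql] := leqP l q.
    rewrite orbT; move: lq; rewrite leq_eqVlt => /orP[/eqP/val_inj<-//|]; exact: A_gt.
  rewrite orbF; have [qj|jq] := leqP q j; last by rewrite andbF; apply/negbTE/nA_mid/andP.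
  have [q0|q0] := posnP q; last by rewrite in_le ?q0.
  by rewrite (_ : q = ord0); [apply: negbTE|apply: val_inj].
apply: Or44; split.
  by move=> hl; case/negP: nfin; apply: final_mono_quo0 => //; apply: ltnW; apply: tbig.
have jl : (j < l)%N by apply: leq_trans ji0 i0l.
exists j; split=> // q; rewrite /P_vars; have [lq|ql] := leqP l.+1 q; first by rewrite orbT A_gt.
rewrite orbF; have [qj|jq] := leqP q j; last first.
  rewrite andbF; apply/negbTE; move: ql; rewrite ltnS leq_eqVlt => /orP[/eqP/val_inj->//|ql].
  by apply: nA_mid; rewrite jq.
have [q0|q0] := posnP q; last by rewrite in_le ?q0.
by rewrite (_ : q = ord0); [apply: negbTE|apply: val_inj].
Qed.

(** * The prime (x_1, ..., x_n) and the depth *)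

Lemma initial_mono_addl i m : initial_mono m -> initial_mono (U_(i) + m)%MM.
Proof. by apply: initial_mono_mono => q _; rewrite mnmDE leq_addl. Qed.

Lemma final_mono_addl i m : final_mono m -> final_mono (U_(i) + m)%MM.
Proof. by apply: final_mono_ge => q _; rewrite mnmDE leq_addl. Qed.

(** The factor [x_0] lets the final part count, and further powers of [x_0]
    change nothing. *)
Lemma colon_tailI t :
  ~~ initial_mono t -> ~~ final_mono t ->
  (forall i, (0 < i)%N -> initial_mono (U_(i) + t)%MM || final_mono (U_(i) + t)%MM) ->
  colon_vars lexseg_mono (U_(ord0) + t)%MM tail_vars.
Proof.
move=> nIt nFt It; apply: colon_varsI => [|i i0|s s0]; first exact: lexseg_mono_up.
  have eq_m : (U_(i) + (U_(ord0) + t) = U_(ord0) + (U_(i) + t))%MM.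
    by rewrite addmA (addmC U_(i)%MM) -addmA.
  rewrite eq_m lexseg_monoE; apply/orP; case/orP: (It i i0) => [Ii|Fi]; [left|right].
    exact: initial_mono_addl.
  by rewrite final_mono_addl // mnmDE mnm1E eqxx.
have sE q : (0 < q)%N -> (s + (U_(ord0) + t))%MM q = t q.
  by move=> q0; rewrite !mnmDE mnm1E s0 //; case: eqP q0 => // <-.
rewrite lexseg_monoE negb_or; apply/andP; split.
  by apply: contra nIt; apply: initial_mono_mono => q /sE ->.
rewrite negb_and; apply/orP; right; apply: contra nFt; apply: final_mono_ge => q lq.
by rewrite sE // (leq_trans l_gt0).
Qed.

Local Notation xn_pow := ((U_(ord_max) *+ (d - 2))%MM : 'X_{1..n.+1}).

Lemma final_mono_add_last t i : (l <= i)%N -> final_mono (U_(i) + (t + xn_pow))%MM.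
Proof.
move=> li; apply: final_mono_ge (final_mono_last li) => q _.
by rewrite !mnmDE leq_add2l leq_addl.
Qed.

Lemma not_final_mono_add_last t :
  (forall q, (l <= q)%N -> t q = 0%N) -> ~~ final_mono (t + xn_pow)%MM.
Proof.
by case: final_socle_last => _ _ g2 t0; apply: g2 => q lq; rewrite mnmDE t0.
Qed.

Lemma xn_pow_lt q : (q < n)%N -> xn_pow q = 0%N.
Proof.
move=> qn; rewrite mulmnE mnm1E; case: (eqVneq ord_max q) => // nq.
by subst q; rewrite ltnn in qn.
Qed.

Lemma tail_deg_xn_pow : tail_deg xn_pow = (d - 2)%N.
Proof.
have n0 : (0 < n)%N by have := l_gt0; have := ltn_ord l; lia.
by have := mdegMn U_(ord_max : 'I_n.+1) (d - 2); rewrite mdeg1 mul1n mdeg_tail xn_pow_lt.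
Qed.

Lemma tail_deg_v : tail_deg v = d.
Proof. by rewrite -deg_v mdeg_tail v0. Qed.

Lemma mnm_sub1K m j : (0 < m j)%N -> (U_(j) + (m - U_(j)))%MM = m.
Proof. by move=> mj; rewrite addmC submK // lep1mP -lt0n. Qed.

(** [x_i v / x_j] has the degree of [v] and is at least [v], as [i <= j]; [t] is
    any multiple of [v / x_j] up to the exponent of [x_0]. *)
Lemma initial_mono_swap i j t :
  (0 < v j)%N -> (0 < i <= j)%N -> (forall q, (0 < q)%N -> ((v - U_(j))%MM q <= t q)%N) ->
  initial_mono (U_(i) + t)%MM.
Proof.
move=> vj /andP[i0 ij] le_t.
have {le_t} : forall q, (0 < q)%N -> ((U_(i) + (v - U_(j)))%MM q <= (U_(i) + t)%MM q)%N.
  by move=> q q0; rewrite !mnmDE leq_add2l le_t.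
move/initial_mono_mono; apply; apply/andP; split.
  have := tail_deg_v; rewrite -{1}(mnm_sub1K vj) !tail_degD !tail_deg1.
  have -> : (j != ord0) by apply: contraTneq ij => ->; rewrite -ltnNge.
  by have -> : (i != ord0) by [apply: contraTneq i0 => ->]; move=> ->.
move: ij; rewrite leq_eqVlt => /orP[/eqP/val_inj ->|ij].
  by rewrite mnm_sub1K //; apply: lex_lt_fromN_le.
have vE q : (q < j)%N -> (v - U_(j))%MM q = v q.
  by move=> qj; rewrite mnmBE mnm1E; case: eqP qj => [->|_ _]; rewrite ?ltnn ?subn0.
apply: (@lex_lt_fromN _ 1 _ v i) => // [q /andP[_ qi]|].
  by rewrite mnmDE vE ?leq_addl // (ltn_trans qi).
by rewrite mnmDE vE // mnm1E eqxx.
Qed.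

(** The monomial [x_n^(d-2)] is in the socle of the final part, so
    [s * x_n^(d-2)] is made final by every variable from [x_l] on, for any
    monomial [s] in the variables before [x_l].  It remains to choose [s] such
    that the product is not in the initial part, but is brought there by the
    variables [x_1, ..., x_(l-1)].  For [l = 1] there is nothing to do.
    Otherwise, let [v = v' v''] be the splitting of [v] before [x_l].
    - If [v'] has degree at most 1, take [s = x_1]: the product has degree
      [d - 1], and another factor before [x_l] puts it above [v].
    - Otherwise the product can have degree [d] or more, and is kept out of the
      initial part by being below [v].  This holds for [s = v'] if [v'']
      contains some variable before [x_n], and for [s = v / x_j] if [v'' = 1],
      in which case [j = l - 1].
    - If [v''] is a power of [x_n], then [v / x_n] is a witness: it has degree
      [d - 1], and every variable makes it at least [v]. *)
Theorem colon_tail j :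
  j \in supp v -> (l <= j.+1)%N -> exists t, colon_vars lexseg_mono t tail_vars.
Proof.
rewrite inE => vj lj.
have l0 := l_gt0; have ln := ltn_ord l; rewrite ltnS in ln.
have [l1|l1] : l = 1%N :> nat \/ (1 < l)%N by lia.
  exists (U_(ord0) + xn_pow)%MM; apply: colon_tailI => [||i i0].
  - by rewrite negb_and -ltnNge tail_deg_xn_pow; apply/orP; left; lia.
  - by rewrite -[xn_pow]add0m; apply: not_final_mono_add_last => q _; rewrite mnm0E.
  - by rewrite final_mono_last ?orbT // l1.
pose low := [multinom if (i < l)%N then v i else 0%N | i < n.+1].
have low_lt q : (q < l)%N -> low q = v q by move=> ql; rewrite mnmE ql.
have low_ge q : (l <= q)%N -> low q = 0%N by move=> lq; rewrite mnmE ltnNge lq.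
have [low1|low2] := leqP (mdeg low) 1.
  pose x : 'I_n.+1 := inord 1.
  have x1 : x = 1%N :> nat by rewrite inordK //; lia.
  exists (U_(ord0) + (U_(x) + xn_pow))%MM; apply: colon_tailI => [||i i0].
  - rewrite negb_and -ltnNge tail_degD tail_deg_xn_pow tail_deg1; apply/orP; left.
    by case: (x != ord0) => /=; lia.
  - apply: not_final_mono_add_last => q lq; rewrite mnm1E.
    by case: (eqVneq x q) => [E|//]; subst q; lia.
  have [li|il] := leqP l i; first by rewrite final_mono_add_last ?orbT.
  apply/orP; left; apply/andP; split.
    rewrite !tail_degD !tail_deg1 tail_deg_xn_pow -!val_eqE /= x1 -lt0n i0; lia.
  have xE : ((U_(i) + (U_(x) + xn_pow))%MM x = (i == x).+1 + xn_pow x)%N.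
    by rewrite !mnmDE !mnm1E eqxx addnA addn1.
  have vx : (v x <= 1)%N by rewrite -low_lt ?x1 //; apply: leq_trans low1; apply: mdeg_ge.
  have [vx0|vx0] := boolP (v x < (i == x).+1)%N.
    apply: (@lex_lt_fromN _ 1 _ v x); rewrite ?xE ?x1 //; first by move=> q; lia.
    by apply: leq_trans vx0 _; rewrite leq_addr.
  have ix : i != x by apply: contra vx0 => /eqP->; rewrite eqxx.
  have v1 : v x = 1%N by move: vx0; rewrite (negPf ix); lia.
  have v_other q : (q < l)%N -> q != x -> v q = 0%N.
    move=> ql qx; have := mdeg_ge2 low qx; rewrite !low_lt ?x1 // v1; lia.
  apply: (@lex_lt_fromN _ 1 _ v i) => // [q /andP[_ qi]|].
    have [->|qx] := eqVneq q x; first by rewrite v1 xE; lia.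
    by rewrite v_other // (ltn_trans qi).
  by rewrite v_other // mnmDE mnm1E eqxx.
have [/existsP[q0 /andP[lq0 vq0]]|/existsPn none] :=
  boolP [exists q : 'I_n.+1, (l <= q < n)%N && (0 < v q)%N].
  case/andP: lq0 => lq0 q0n; exists (U_(ord0) + (low + xn_pow))%MM.
  have t_mid q : (l <= q < n)%N -> (low + xn_pow)%MM q = 0%N.
    by case/andP=> lq qn; rewrite mnmDE low_ge // xn_pow_lt.
  have t_lt q : (q < l)%N -> (low + xn_pow)%MM q = v q.
    by move=> ql; rewrite mnmDE low_lt // xn_pow_lt ?addn0 // (leq_trans ql).
  apply: colon_tailI => [||i i0].
  - rewrite negb_and negbK; apply/orP; right; apply: contraT => /lex_lt_from_total[eq_t|].
      by have := eq_t q0 (leq_trans l0 lq0); rewrite t_mid ?lq0 // => E; rewrite -E in vq0.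
    case/lex_lt_fromP=> p [p0 lt_p agree].
    have lp : (l <= p)%N by rewrite leqNgt; apply: contraTN lt_p => pl; rewrite t_lt // ltnn.
    have np : (n <= p)%N by rewrite leqNgt; apply: contraTN lt_p => pn; rewrite t_mid ?lp.
    have := agree q0; rewrite (leq_trans l0 lq0) (leq_trans q0n np) t_mid ?lq0 // => /(_ isT) E.
    by rewrite E in vq0.
  - exact: not_final_mono_add_last low_ge.
  have [li|il] := leqP l i; first by rewrite final_mono_add_last ?orbT.
  apply/orP; left; apply/andP; split.
    rewrite !tail_degD tail_deg1 tail_deg_xn_pow -lt0n i0.
    by move: low2; rewrite mdeg_tail low_lt // v0; lia.
  apply: (@lex_lt_fromN _ 1 _ v i) => // [q /andP[_ qi]|].
    by rewrite mnmDE t_lt ?leq_addl // (ltn_trans qi).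
  by rewrite mnmDE t_lt // mnm1E eqxx.
have v_mid q : (l <= q < n)%N -> v q = 0%N.
  by move=> lqn; have := none q; rewrite lqn /=; lia.
have [vn|vn] := posnP (v ord_max).
  have v_ge q : (l <= q)%N -> v q = 0%N.
    move=> lq; have := ltn_ord q; rewrite ltnS leq_eqVlt => /orP[/eqP qn|qn].
      by rewrite (_ : q = ord_max) //; apply: val_inj.
    by rewrite v_mid ?lq.
  have jl : (j < l)%N by rewrite ltnNge; apply: contraTN vj => /v_ge ->.
  exists (U_(ord0) + ((v - U_(j)) + xn_pow))%MM; apply: colon_tailI => [||i i0].
  - apply: (@not_initial_mono j) => [||q /andP[_ qj]]; first by lia.
      by rewrite mnmDE mnmBE mnm1E eqxx xn_pow_lt; lia.
    rewrite mnmDE mnmBE mnm1E xn_pow_lt ?addn0; last lia.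
    by case: eqP qj => [->|_ _]; rewrite ?ltnn ?subn0.
  - by apply: not_final_mono_add_last => q lq; rewrite mnmBE v_ge.
  have [li|il] := leqP l i; first by rewrite final_mono_add_last ?orbT.
  apply/orP; left; apply: (@initial_mono_swap i j) => // [|q _]; first by lia.
  by rewrite mnmDE leq_addr.
exists (U_(ord0) + (v - U_(ord_max)))%MM; apply: colon_tailI => [||i i0].
- rewrite negb_and -ltnNge; apply/orP; left.
  have := tail_deg_v; rewrite -{1}(mnm_sub1K vn) tail_degD tail_deg1.
  have -> : (ord_max != ord0 :> 'I_n.+1) by rewrite -val_eqE /=; lia.
  by move=> <-; rewrite add1n.
- apply/final_monoP => -[w [dw uw /mnm_lepP wm]].
  have : (mdeg w <= mdeg (U_(ord_max : 'I_n.+1) *+ v ord_max))%N.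
    apply: mdeg_le => q; rewrite mulmnE mnm1E.
    have [lq|ql] := leqP l q; last by rewrite (le_quo0_lt uw).
    apply: leq_trans (wm q) _; rewrite mnmBE; case: (eqVneq ord_max q) => [<-|nq] /=.
      by rewrite mul1n leq_subr.
    by rewrite v_mid // lq; move: nq (ltn_ord q); rewrite -val_eqE /=; lia.
  have : (mdeg (low + U_(ord_max) *+ v ord_max)%MM <= mdeg v)%N.
    apply: mdeg_le => q; rewrite mnmDE mulmnE mnm1E; case: (eqVneq ord_max q) => [<-|nq] /=.
      by rewrite low_ge ?leq_ord // mul1n.
    by rewrite addn0 mnmE; case: ifP.
  by rewrite mdegD mdegMn mdeg1 mul1n dw deg_v; lia.
by apply/orP; left; apply: (@initial_mono_swap i ord_max) => //; rewrite i0 leq_ord.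
Qed.

(** The only way to enter the initial part by multiplying with a variable beyond
    those of [v] is to reach the degree [d]; then multiplying with any other
    variable but [x_0] has the same effect. *)
Lemma initial_mono_regular q m :
  socle_free lexseg_mono ->
  (forall t, ~ colon_vars lexseg_mono t tail_vars) ->
  (forall j, j \in supp v -> (j < q)%N) ->
  initial_mono (U_(q) + m)%MM -> initial_mono m.
Proof.
move=> no_socle no_tail vq Iqm; apply: contraT => nIm; exfalso.
have nlt : ~~ lex_lt_from 1 m v.
  case/andP: Iqm => _; apply: contra => /lex_lt_fromP[j [j0 lt_j agree]].
  have jq : (j < q)%N by apply: vq; rewrite inE; lia.
  have mE p : (p < q)%N -> (U_(q) + m)%MM p = m p.
    by move=> pq; rewrite mnmDE mnm1E; case: eqP pq => // ->; rewrite ltnn.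
  apply/lex_lt_fromP; exists j; split; rewrite ?mE // => i ij.
  by rewrite mE ?agree //; lia.
have It i : (0 < i)%N -> initial_mono (U_(i) + m)%MM.
  move=> i0; apply/andP; split; last first.
    by apply: contra nlt; apply: lex_lt_from_mono => p _; rewrite mnmDE leq_addl.
  case/andP: Iqm; rewrite !tail_degD !tail_deg1 => dm _.
  have -> : (i != ord0) by apply: contraTneq i0 => ->.
  by case: (q != ord0) dm; lia.
pose t := [multinom if i == ord0 then 0%N else m i | i < n.+1].
have tE i : (0 < i)%N -> t i = m i by move=> i0; rewrite mnmE; case: eqP i0 => // ->.
have nIt : ~~ initial_mono t.
  by apply: contra nIm; apply: initial_mono_mono => i i0; rewrite tE.
have It' i : (0 < i)%N -> initial_mono (U_(i) + t)%MM.
  by move=> /It; apply: initial_mono_mono => p p0; rewrite !mnmDE tE.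
(* All the variables but [x_0] bring [t] into the initial part.  If [t] is
   final, so does [x_0] into the ideal, and [t] is in the socle; otherwise
   [x_0 t] has the excluded annihilator. *)
have [Ft|nFt] := boolP (final_mono t).
  have : lexseg_mono t.
    apply: no_socle => i; rewrite lexseg_monoE; have [i0|/It' ->//] := posnP i.
    rewrite final_mono_addl // mnmDE mnm1E (_ : i = ord0) ?eqxx ?orbT //.
    exact: val_inj.
  by rewrite lexseg_monoE (negPf nIt) mnmE eqxx.
by apply: (no_tail (U_(ord0) + t)%MM); apply: colon_tailI => // i /It' ->.
Qed.

(** [x_0] is regular and [x_n] nilpotent modulo the sum of the initial and final
    parts, and conversely modulo the initial part and [x_0]; these two ideals
    intersect in the lexsegment ideal, and all this persists modulo
    [x_(l-1)]. *)
Theorem regular_pair (K : fieldType) :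
  socle_free lexseg_mono ->
  (forall t, ~ colon_vars lexseg_mono t tail_vars) ->
  (forall j, j \in supp v -> (j.+2 <= l)%N) ->
  exists f1 f2, [/\ max_ideal f1, max_ideal f2
    & regular_seq (mono_ideal (K := K) lexseg_mono) [:: f1; f2]].
Proof.
move=> no_socle no_tail vl; have l0 := l_gt0; have ln := ltn_ord l.
have upD := lexseg_mono_up; have regI := initial_mono_regular no_socle no_tail.
pose p : 'I_n.+1 := inord (l - 1).
have pl : p = (l - 1)%N :> nat by rewrite inordK //; lia.
have var_max i : max_ideal ('X_i : {mpoly K[n.+1]}) by apply: gen_ideal_gen; exists i.
have idmax : is_ideal (max_ideal (K := K) (n := n.+1)) := gen_ideal_is_ideal _.
exists 'X_p, ('X_ord0 + 'X_ord_max); split=> //.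
  by case: idmax => _ maxD _; apply: maxD.
have regIp m : initial_mono (U_(p) + m)%MM -> initial_mono m.
  by apply: regI => j /vl; rewrite pl; lia.
have regIn m : initial_mono (U_(ord_max) + m)%MM -> initial_mono m.
  by apply: regI => j /vl /=; lia.
have drop_final i m : (i < l)%N -> final_mono (U_(i) + m)%MM -> final_mono m.
  move=> il; apply: final_mono_ge => q lq; rewrite mnmDE mnm1E.
  by case: (eqVneq i q) => // iq; subst q; lia.
have add0E i q m : i != q -> (U_(i) + m)%MM q = m q.
  by move=> iq; rewrite mnmDE mnm1E (negPf iq).
have l3 : (2 < l)%N.
  have [j vj] : exists j, (0 < v j)%N.
    apply/existsP; apply: contraT => /existsPn none.
    suff : (mdeg v <= 0)%N by rewrite deg_v; lia.
    by rewrite mdegE big1 // => j _; have := none j; lia.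
  have sj : j \in supp v by rewrite inE.
  by have := vl j sj; have := supp_v_gt0 sj; lia.
have p0 : p != ord0 by rewrite -val_eqE /= pl; lia.
have n0 : ord_max != ord0 :> 'I_n.+1 by rewrite -val_eqE /=; lia.
have np : ord_max != p by rewrite -val_eqE /= pl; lia.
have finp m : final_mono (U_(p) + m)%MM -> final_mono m by apply: drop_final; lia.
split=> [h|].
  rewrite mulrC => /mono_idealMX Ih m /Ih; rewrite addmC !lexseg_monoE add0E //.
  by case/orP=> [/regIp->//|/andP[-> /finp ->]]; rewrite orbT.
pose D1 : pred 'X_{1..n.+1} := fun m => [|| final_mono m, initial_mono m | (0 < m p)%N].
pose D2 : pred 'X_{1..n.+1} := fun m => [|| (0 < m ord0)%N, initial_mono m | (0 < m p)%N].
have upI m m' : initial_mono m -> initial_mono (m + m')%MM.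
  by apply: initial_mono_mono => q _; rewrite mnmDE leq_addr.
have upF m m' : final_mono m -> final_mono (m + m')%MM.
  by apply: final_mono_ge => q _; rewrite mnmDE leq_addr.
have upD1 : up_closed D1.
  move=> m m' /or3P[/upF Fm|/upI Im|mp]; apply/or3P; [exact: Or31|exact: Or32|apply: Or33].
  by rewrite mnmDE addn_gt0 mp.
have upD2 : up_closed D2.
  move=> m m' /or3P[m0|/upI Im|mp]; apply/or3P; [apply: Or31|exact: Or32|apply: Or33].
    by rewrite mnmDE addn_gt0 m0.
  by rewrite mnmDE addn_gt0 mp.
have adjE := adjoin_varE p upD.
split=> [h /adjE Ih|].
  have Ih1 : mono_ideal D1 h.
    apply: (@regular_add_nilpotent _ (mono_ideal D1) 'X_ord0 'X_ord_max d).
    - exact: mono_ideal_is_ideal.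
    - move=> f; rewrite mulrC => /mono_idealMX If m /If; rewrite addmC /D1 add0E 1?eq_sym //.
      case/or3P=> [/drop_final -> //|/initial_mono_mono->|->]; rewrite ?orbT //.
      by move=> q q0; rewrite add0E //; apply: contraTneq q0 => <-.
    - rewrite mpolyXn; apply/(mono_idealX K D1)/or3P/Or31.
      apply: final_mono_ge (final_mono_last (i := ord_max) (leq_ord l)) => q _.
      by rewrite mnmDE !mulmnE !mnm1E; case: (ord_max == q) => //=; lia.
    - move=> m /Ih; rewrite lexseg_monoE => /orP[/orP[Im|/andP[_ Fm]]|mp]; apply/or3P.
      + exact: Or32.
      + exact: Or31.
      + exact: Or33.
  have Ih2 : mono_ideal D2 h.
    apply: (@regular_add_nilpotent _ (mono_ideal D2) 'X_ord_max 'X_ord0 1).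
    - exact: mono_ideal_is_ideal.
    - move=> f; rewrite mulrC => /mono_idealMX If m /If; rewrite addmC /D2 !add0E //.
      by case/or3P=> [->//|/regIn->|->]; rewrite ?orbT.
    - by rewrite expr1; apply/(mono_idealX K D2); rewrite /D2 mnm1E eqxx.
    - rewrite addrC => m /Ih; rewrite lexseg_monoE.
      case/orP=> [/orP[Im|/andP[m0 _]]|mp]; apply/or3P.
      + exact: Or32.
      + exact: Or31.
      + exact: Or33.
  apply/adjE => m hm; rewrite lexseg_monoE.
  have := Ih1 m hm; have := Ih2 m hm; rewrite /D1 /D2.
  by case: (initial_mono m) (0 < m p)%N (0 < m ord0)%N => [] [] [].
have [_ max1 _] : prime_ideal (max_ideal (K := K) (n := n.+1)) by apply: var_ideal_prime.
apply: contra_not max1; apply: gen_ideal_min => // f [|->]; last first.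
  by case: idmax => _ maxD _; apply: maxD.
apply: gen_ideal_min f => // f [If|->//].
apply/var_idealE => m /If /lexseg_mono_deg dm; apply: contraT => /existsPn none.
suff : (mdeg m <= 0)%N by lia.
by rewrite mdegE big1 // => j _; have := none j; rewrite /=; lia.
Qed.

End Lexsegment.

(** * Associated primes of lexsegment ideals *)

(* There are n.+1 variables; ord0 and ord_max index the first and the last. *)
Theorem proposition2p5 (K : fieldType) (n d : nat) (u v : 'X_{1..n.+1})
    (l : 'I_n.+1) (k : nat)
    (hd : (2 <= d)%N) (hu : mdeg u = d) (hv : mdeg v = d)
    (huv : lex_ge u v)
    (hx1u : ord0 \in supp u) (hx1v : ord0 \notin supp v)
    (hl : is_min (u - U_(ord0))%MM l)
    (hdepth : depth_quot (lexsegment_ideal K d u v) k) (hk : (0 < k)%N) :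
  let I := lexsegment_ideal K d u v in
  let al := (u - U_(ord0))%MM l in
  (k = 1%N ->
     ((al < d - 1)%N ->
        forall P : {mpoly K[n.+1]} -> Prop, Ass I P <->
          [\/ ideal_eq P (tail_ideal K n.+1),
              exists j, [/\ j \in supp v, j != ord_max
                          & ideal_eq P (initial_ideal K n.+1 j)],
              exists j, [/\ j \in supp v, (j.+2 <= l)%N
                          & ideal_eq P (P_ideal K n.+1 j l)]
            | exists j, [/\ j \in supp v, (j.+1 <= l)%N
                          & ideal_eq P (P_ideal K n.+1 j l.+1)]])
     /\
     (al = (d - 1)%N ->
        forall P : {mpoly K[n.+1]} -> Prop, Ass I P <->
          [\/ ideal_eq P (tail_ideal K n.+1),
              exists j, [/\ j \in supp v, j != ord_max
                          & ideal_eq P (initial_ideal K n.+1 j)]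
            | exists j, [/\ j \in supp v, (j.+2 <= l)%N
                          & ideal_eq P (P_ideal K n.+1 j l)]]))
  /\
  ((1 < k)%N ->
     ((al < d - 1)%N ->
        forall P : {mpoly K[n.+1]} -> Prop, Ass I P <->
          [\/ exists j, [/\ j \in supp v, j != ord_max
                          & ideal_eq P (initial_ideal K n.+1 j)],
              exists j, j \in supp v /\ ideal_eq P (P_ideal K n.+1 j l)
            | exists j, j \in supp v /\ ideal_eq P (P_ideal K n.+1 j l.+1)])
     /\
     (al = (d - 1)%N ->
        forall P : {mpoly K[n.+1]} -> Prop, Ass I P <->
          (exists j, [/\ j \in supp v, j != ord_max
                       & ideal_eq P (initial_ideal K n.+1 j)])
          \/ (exists j, j \in supp v /\ ideal_eq P (P_ideal K n.+1 j l)))).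
Proof.
move=> I al; pose D := lexseg_mono d u v.
have upD : up_closed D by apply: lexseg_mono_up.
have depthD : depth_quot (K := K) (mono_ideal D) k.
  exact: is_depth_ext (@lexsegment_idealE n d u v K) hdepth.
have no_socle := depth_gt0_no_socle upD depthD hk.
have v0 : v ord0 = 0%N by move: hx1v; rewrite inE -leqNgt leqn0 => /eqP.
have u0 : u ord0 = 1%N.
  by apply: (exponent_first hd hu) no_socle => //; move: hx1u; rewrite inE.
have AssE P : Ass I P <-> exists t A,
    colon_vars D t A /\ ideal_eq P (var_ideal (K := K) A).
  by rewrite -(Ass_mono_ideal P upD); apply: Ass_ext; apply: lexsegment_idealE.
have Ass_init P j : j \in supp v -> j != ord_max ->
    ideal_eq P (initial_ideal K n.+1 j) -> Ass I P.
  move=> sj jn eqPA; have [t colt] := colon_initial hd hu u0 hl v0 hv sj jn.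
  by apply/AssE; exists t, (initial_vars j).
have Ass_Pl P j : j \in supp v -> (j.+2 <= l)%N ->
    ideal_eq P (P_ideal K n.+1 j l) -> Ass I P.
  move=> sj jl eqPA; have socl := final_socle_last hd hu u0 hl.
  have [|t colt] := colon_P hd hu u0 v0 hv sj jl _ socl.
    by rewrite leqnn leqnSn.
  by apply/AssE; exists t, (P_vars j l).
have Ass_Pnext P j : (al < d - 1)%N -> j \in supp v -> (j.+1 <= l)%N ->
    ideal_eq P (P_ideal K n.+1 j l.+1) -> Ass I P.
  move=> hal sj jl eqPA; have [g socg] := final_socle_next hd hu u0 hl hal.
  have [||t colt] := colon_P hd hu u0 v0 hv sj _ _ socg => //.
    by rewrite leqnn leqnSn.
  by apply/AssE; exists t, (P_vars j l.+1).
have Ass_cases P : Ass I P ->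
    [\/ exists t, colon_vars D t (@tail_vars n) /\ ideal_eq P (tail_ideal K n.+1),
        exists j, [/\ j \in supp v, j != ord_max & ideal_eq P (initial_ideal K n.+1 j)],
        exists j, [/\ j \in supp v, (j.+2 <= l)%N & ideal_eq P (P_ideal K n.+1 j l)]
      | al <> (d - 1)%N /\ exists j, [/\ j \in supp v, (j.+1 <= l)%N
          & ideal_eq P (P_ideal K n.+1 j l.+1)]].
  have trans A B : ideal_eq P (var_ideal A) -> A =1 B -> ideal_eq P (var_ideal B).
    by move=> eqPA eqAB f; rewrite eqPA; apply: var_ideal_ext.
  move/AssE=> [t [A [colA /trans eqPA]]].
  case: (colon_cases hd hu u0 hl v0 hv no_socle colA).
  - move=> eqA; apply: Or41; exists t; split; last exact: eqPA eqA.
    exact: colon_vars_ext eqA colA.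
  - by case=> j [sj jn /eqPA eqA]; apply: Or42; exists j.
  - by case=> j [sj jl /eqPA eqA]; apply: Or43; exists j.
  - by case=> hal [j [sj jl /eqPA eqA]]; apply: Or44; split=> //; exists j.
split=> [k1|k2].
  have [t colt] : exists t, colon_vars D t (@tail_vars n).
    apply: NNPP => no_tail.
    have no_tail' t : ~ colon_vars D t (@tail_vars n) by move=> colt; apply: no_tail; exists t.
    have vl j : j \in supp v -> (j.+2 <= l)%N.
      move=> sj; rewrite leqNgt ltnS; apply/negP => lj; apply: no_tail.
      exact: (colon_tail hd hu u0 hl v0 hv sj lj).
    have [f1 [f2 [max1 max2 reg]]] := regular_pair hd hu u0 hl v0 hv K no_socle no_tail' vl.
    have : (2 <= k)%N; last by rewrite k1.
    by case: depthD => _ /(_ [:: f1; f2]); apply=> // f; rewrite !inE => /orP[]/eqP->.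
  have Ass_tail P : ideal_eq P (tail_ideal K n.+1) -> Ass I P.
    by move=> eqPA; apply/AssE; exists t, (@tail_vars n).
  split=> hal P; split.
  - case/Ass_cases=> [[t' [_ eqPA]]|||[_]]; [exact: Or41|exact: Or42|exact: Or43|exact: Or44].
  - case=> [/Ass_tail//|[j [sj jn /Ass_init]]|[j [sj jl /Ass_Pl]]|[j [sj jl /Ass_Pnext]]]; exact.
  - by case/Ass_cases=> [[t' [_ eqPA]]|||[/(_ hal)]] //; [exact: Or31|exact: Or32|exact: Or33].
  - by case=> [/Ass_tail//|[j [sj jn /Ass_init]]|[j [sj jl /Ass_Pl]]]; apply.
have no_tail t : ~ colon_vars D t (@tail_vars n).
  move=> colt; suff: (k <= 1)%N by rewrite leqNgt k2.
  by apply: (depth_le1 upD depthD (colon_vars0 colt)) => i i0; rewrite (colon_vars1 _ colt).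
have vl j : j \in supp v -> (j.+2 <= l)%N.
  move=> sj; rewrite leqNgt ltnS; apply/negP => lj.
  by have [t /no_tail] := colon_tail hd hu u0 hl v0 hv sj lj.
split=> hal P; split.
- case/Ass_cases=> [[t [/no_tail//]]|||[_]]; first exact: Or31.
    by case=> j [sj _ eqPA]; apply: Or32; exists j.
  by case=> j [sj _ eqPA]; apply: Or33; exists j.
- case=> [[j [sj jn /Ass_init]]|[j [sj /Ass_Pl]]|[j [sj /Ass_Pnext]]]; apply=> //; try exact: vl.
  exact: ltnW (vl _ sj).
- case/Ass_cases=> [[t [/no_tail//]]||| [/(_ hal)//]]; first by left.
  by case=> j [sj _ eqPA]; right; exists j.
- by case=> [[j [sj jn /Ass_init]]|[j [sj /Ass_Pl]]]; apply=> //; apply: vl.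
Qed.
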